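(* For all $0\le\beta<2$, there exists a constant $C_\beta$ such that for all positive integers $n$ and all $\varepsilon>0$, $$\Pr_{X\sim\mathcal{G}^{n\times n}}\left[|\mathrm{Det}(X)|<\varepsilon\sqrt{n!}\right]<C_\beta\, n^{\beta(\beta+2)/8}\,\varepsilon^{\beta}.$$
   Context: $\mathcal{G}=\mathcal{N}(0,1)_{\mathbb{C}}$ is the complex Gaussian distribution with mean $0$ and $\mathrm{E}|z|^2=1$; $\mathcal{G}^{n\times n}$ is the distribution over $n\times n$ complex matrices with i.i.d. entries from $\mathcal{G}$. $\mathrm{Det}$ is the determinant. *)

(* Defs.v *)
From HB Require Import structures.
From mathcomp Require Export all_boot all_order all_algebra.
From mathcomp Require Export all_classical all_reals all_analysis.
From mathcomp Require Export complex.

Set Implicit Arguments.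
Unset Strict Implicit.
Unset Printing Implicit Defensive.

Import Order.TTheory GRing.Theory Num.Theory.
Import numFieldNormedType.Exports.

Local Open Scope classical_set_scope.
Local Open Scope ring_scope.

(* R[i] carries no measurable structure in the libraries; its Borel
   sigma-algebra is the one of R * R, transported by this bijection. *)
Definition plane_of_complex (R : realType) (z : R[i]) : R * R :=
  (complex.Re z, complex.Im z).

(* Law of (Re z, Im z) for z of law N(0,1)_C: the two parts are independent
   centered normals of variance 1/2 each, so that E|z|^2 = 1. The second
   argument of normal_prob is the standard deviation, not the variance. *)
Definition complex_gaussian (R : realType) : set (R * R) -> \bar R :=
  (normal_prob 0 (Num.sqrt 2^-1) \x normal_prob 0 (Num.sqrt 2^-1))%E.

Definition mutually_independent (R : realType) (d d' : measure_display)
    (T : measurableType d) (U : measurableType d') (P : probability T R)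
    (I : finType) (Z : I -> T -> U) : Prop :=
  forall (J : {set I}) (A : I -> set U), (forall i, measurable (A i)) ->
    P (\bigcap_(i in [set i | i \in J]) (Z i @^-1` A i)) =
    (\prod_(i in J) P (Z i @^-1` A i))%E.

Definition gaussian_matrix (R : realType) (d : measure_display)
    (T : measurableType d) (P : probability T R) (n : nat)
    (X : T -> 'M[R[i]]_n) : Prop :=
  let Z (ij : 'I_n * 'I_n) (t : T) := plane_of_complex (X t ij.1 ij.2) in
  [/\ forall ij, measurable_fun [set: T] (Z ij),
      forall ij (A : set (R * R)), measurable A ->
        P (Z ij @^-1` A) = complex_gaussian A
    & mutually_independent P Z].

(* Main.v *)
Require Import Defs.
From HB Require Import structures.
From mathcomp Require Import measurable_realfun.
From mathcomp Require Import ring lra.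

Set Implicit Arguments.
Unset Strict Implicit.
Unset Printing Implicit Defensive.

Import Order.TTheory GRing.Theory Num.Theory.
Import numFieldNormedType.Exports.

Local Open Scope classical_set_scope.
Local Open Scope ring_scope.

(** Put a = beta / 2 and expand the determinant along its first row r. A product
    of Givens rotations takes r to (rho, 0, ..., 0) with |rho| = ||r||, and the
    law of the other rows is invariant under it; hence, conditionally on r,
    |det X|^2 has the law of ||r||^2 |det Y|^2, where Y is a Gaussian matrix of
    size n - 1. So if P(|det Y|^2 < delta) <= M delta^a for all delta, then
    P(|det X|^2 < delta) <= M E(||r||^(-2a)) delta^a.

    It remains to bound E(||r||^(-2a)) sharply enough for the product over n to
    be O(n^(a(a+1)/2) / n!^a). From E exp(-c ||r||^2) = (1 + c)^(-n), integration
    in c yields E ||r||^(-2k) = 1 / ((n-1) ... (n-k)). Bounding y^a by its cubic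
    Taylor polynomial at 1, with y = (n-1) / ||r||^2, gives
    n^a E(||r||^(-2a)) <= exp (a(a+1)/2 / (n-2) + 1 / ((n-2)(n-3))) for n >= 4,
    and the last terms telescope. *)


(** * Product measures on tuples *)

(** The tangent bound y^a <= 1 + a(y-1) alone would give E(||r||^(-2a)) <= (n-1)^(-a), hence a
    factor n^a after telescoping, that is n^(beta/2). The smaller exponent a(a+1)/2 = a - a(1-a)/2
    comes from the second-order term, since y has mean 1 and variance about 1/n. The quadratic
    Taylor polynomial is not an upper bound for y > 1, so degree three is used; this calls for third
    inverse moments, hence n >= 4. Sizes 2 and 3 rely on the tangent bound, size 1 on a direct
    estimate. The induction propagates the tail bound M delta^a instead of the moment E(|det
    X|^(-2a)): for n = 1 that moment is Gamma(1-a), unbounded as a tends to 1. *)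

Section law.
Context d d' (T : measurableType d) (T' : measurableType d') (R : realType).
Variables (P : probability T R) (f : T -> T') (mf : measurable_fun setT f).

Let mf_mixin := isMeasurableFun.Build _ _ _ _ _ mf.
Let mf_pack : {mfun T >-> T'} := HB.pack f mf_mixin.

Definition law : probability T' R := distribution P mf_pack.

Lemma lawE A : law A = P (f @^-1` A). Proof. by []. Qed.

Lemma ge0_integral_law (g : T' -> \bar R) : measurable_fun setT g ->
  (forall y, 0 <= g y)%E ->
  (\int[law]_y g y = \int[P]_x g (f x))%E.
Proof. by move=> mg g0; rewrite ge0_integral_distribution. Qed.

End law.

(** The class [D] of sides is a parameter because, for matrices, the sides are themselves boxes of
    rows. *)
Definition rectangle T n (D : set (set T)) : set (set (n.-tuple T)) :=
  [set B | exists2 A : 'I_n -> set T,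
     (forall i, D (A i)) & B = [set x | forall i, A i (tnth x i)]].
Arguments rectangle {T} n D.

Section tuple_measure.
Context d (T : measurableType d) (R : realType).

Lemma rectangle_setI n (D : set (set T)) :
  setI_closed D -> setI_closed (rectangle n D).
Proof.
move=> DI _ _ [A AD ->] [B BD ->]; exists (fun i => A i `&` B i).
  by move=> i; exact: DI.
apply/seteqP; split=> [x [xA xB] i|x xAB]; first by split.
by split=> i; have [] := xAB i.
Qed.

Lemma measurable_box n (A : 'I_n -> set T) : (forall i, measurable (A i)) ->
  measurable [set x : n.-tuple T | forall i, A i (tnth x i)].
Proof.
move=> mA; rewrite (_ : [set x | _] =
    \bigcap_(i in [set: 'I_n]) ((fun x : n.-tuple T => tnth x i) @^-1` A i)).
  apply: fin_bigcap_measurable => // i _.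
  by rewrite -[X in measurable X]setTI; exact: measurable_tnth.
by apply/seteqP; split=> [x xA i _|x xA i]; [exact: xA|exact: xA].
Qed.

Lemma measurable_rectangle n (D : set (set T)) :
  D setT -> measurable = <<s D >> :> set (set T) ->
  measurable = <<s rectangle n D >> :> set (set (n.-tuple T)).
Proof.
move=> DT mD; have DM A : D A -> measurable A.
  by move=> DA; rewrite mD; exact: sub_sigma_algebra.
apply/seteqP; split; last first.
  apply: smallest_sub; first exact: sigma_algebra_measurable.
  by move=> _ [A AD ->]; apply: measurable_box => i; exact/DM/AD.
apply: smallest_sub; first exact: smallest_sigma_algebra.
rewrite -bigcup_seq/=; apply: bigcup_sub => i _ _ [B mB <-].
rewrite setTI; move: B mB; rewrite mD.
(* Good-sets argument: the sets whose cylinder along coordinate [i] is generated by boxes form a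
   sigma-algebra containing [D]. *)
pose S : set (set T) := [set B | <<s rectangle n D >>
  ((fun x : n.-tuple T => tnth x i) @^-1` B)].
change (<<s D >> `<=` S).
have [S0 SD SU] := @smallest_sigma_algebra _ [set: n.-tuple T] (rectangle n D).
apply: smallest_sub.
  split=> [|B SB|F SF].
  - by rewrite /S/= preimage_set0.
  - by rewrite /S/= setTD preimage_setC -setTD; exact: SD.
  - by rewrite /S/= preimage_bigcup; exact: SU.
move=> B DB; apply: sub_sigma_algebra.
(* A cylinder is a box whose other sides are [setT]; hence the hypothesis [D setT]. *)
exists (fun j => if j == i then B else setT); first by move=> j; case: ifP.
apply/seteqP; split=> [x Bx j|x /(_ i)]; last by rewrite eqxx.
by case: eqP => // ->.
Qed.

(** Boxes with sides in [D] are stable under intersection and generate the sigma-algebra, so the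
    uniqueness theorem for finite measures applies. All equalities of laws on tuples below go
    through this. *)
Lemma tuple_measure_unique n (D : set (set T))
    (m1 m2 : probability (n.-tuple T) R) :
  D setT -> setI_closed D -> measurable = <<s D >> :> set (set T) ->
  (forall A : 'I_n -> set T, (forall i, D (A i)) ->
     m1 [set x | forall i, A i (tnth x i)] =
     m2 [set x | forall i, A i (tnth x i)]) ->
  forall A, measurable A -> m1 A = m2 A.
Proof.
move=> DT DI mD m12 A mA.
apply: (@measure_unique _ R _ (rectangle n D) (fun=> setT)) => //.
- exact: measurable_rectangle.
- exact: rectangle_setI.
- by move=> _; exists (fun=> setT) => //; apply/seteqP; split.
- by rewrite bigcup_const.
- by move=> _ [B DB ->]; exact: m12.
- by move=> _; apply: (le_lt_trans (probability_le1 m1 measurableT)); rewrite ltry.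
Qed.

Definition cons_pair n (p : T * n.-tuple T) : n.+1.-tuple T :=
  [tuple of p.1 :: p.2].

Lemma measurable_cons_pair n : measurable_fun setT (@cons_pair n).
Proof. exact: measurable_cons. Qed.

(** Built as an image under [cons], so that Tonelli peels off the first coordinate (the first row,
    for matrices). *)
Fixpoint tprod (nu : probability T R) n : probability (n.-tuple T) R :=
  match n with
  | 0 => dirac [tuple]
  | n.+1 => law (nu \x tprod nu n)%E (@measurable_cons_pair n)
  end.

Lemma ge0_integral_tprodS nu n (f : n.+1.-tuple T -> \bar R) :
  measurable_fun setT f -> (forall x, 0 <= f x)%E ->
  (\int[tprod nu n.+1]_x f x =
   \int[nu]_z \int[tprod nu n]_x f [tuple of z :: x])%E.
Proof.
move=> mf f0; rewrite /= ge0_integral_law//.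
rewrite (fubini_tonelli1 (fun p => f (cons_pair p)))//.
exact: measurableT_comp mf (@measurable_cons_pair n).
Qed.

Lemma tprodS nu n (A : set (n.+1.-tuple T)) :
  tprod nu n.+1 A =
  (\int[nu]_z tprod nu n [set x : n.-tuple T | A [tuple of z :: x]])%E.
Proof.
transitivity ((nu \x tprod nu n)%E (@cons_pair n @^-1` A)) => //.
rewrite /product_measure1; apply: eq_integral => z _ /=.
by congr (tprod _ _ _); apply/seteqP; split => x /=; rewrite /xsection/= inE.
Qed.

Lemma tprod_box nu n (A : 'I_n -> set T) : (forall i, measurable (A i)) ->
  tprod nu n [set x | forall i, A i (tnth x i)] = (\prod_i nu (A i))%E.
Proof.
elim: n A => [|n IHn] A mA.
  by rewrite big_ord0 /= diracE mem_set//= => -[].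
have box0 z : [set x : n.-tuple T |
      [set y | forall i, A i (tnth y i)] [tuple of z :: x]] =
    [set x | A ord0 z /\ forall i, A (lift ord0 i) (tnth x i)].
  apply/seteqP; split=> x /=.
    by move=> xA; split=> [|i]; [exact: (xA ord0)|
      have := xA (lift ord0 i); rewrite tnthS].
  move=> [zA xA] i; case: (unliftP ord0 i) => [j ->|->//].
  by rewrite tnthS; exact: xA.
rewrite tprodS big_ord_recl.
under eq_integral do rewrite box0.
rewrite -(IHn (fun i => A (lift ord0 i)))//.
rewrite (eq_integral (fun z => (\1_(A ord0) z)%:E *
  tprod nu n [set x | forall i, A (lift ord0 i) (tnth x i)])%E).
  rewrite ge0_integralZr//= ?integral_indic ?setIT//.
  exact/measurable_EFinP/measurable_indic.
move=> z _; rewrite indicE; case: (boolP (z \in _)) => zA.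
  rewrite mul1e; congr (tprod _ _ _); apply/seteqP; split=> x /=.
    by case.
  by move=> xA; split=> //; rewrite inE in zA.
rewrite mul0e (_ : [set x | _] = set0) ?measure0//.
by apply/seteqP; split=> // x /= [zA']; move: zA; rewrite notin_setE.
Qed.

End tuple_measure.

(** * Lebesgue measure on the plane *)

Section lebesgue_plane.
Context (R : realType).
Local Notation mu := (@lebesgue_measure R).
Local Notation K := (measurableTypeR R * measurableTypeR R)%type.

(* A named copy, because the library infers no sigma-finite instance for the
   product of two measures that are not subprobabilities. *)
Definition lebesgue2 : set K -> \bar R := (mu \x mu)%E.
HB.instance Definition _ := Measure.on lebesgue2.

Let lebesgue2_sigma_finite : sigma_finite setT lebesgue2.
Proof.
have /sigma_finiteP[F [TF ndF Foo]] := sigma_finiteT mu.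
(* The exhaustion is increasing, so a point lies in the square whose index is the larger of those of
   its two coordinates. *)
exists (fun n => F n `*` F n).
  apply/seteqP; split=> // -[x y] _.
  have : (\bigcup_i F i) x by rewrite -TF.
  have : (\bigcup_i F i) y by rewrite -TF.
  move=> [n _ Fny] [k _ Fkx]; exists (maxn n k) => //; split=> /=.
    by move: x Fkx; exact/subsetPset/ndF/leq_maxr.
  by move: y Fny; exact/subsetPset/ndF/leq_maxl.
move=> n; have [mF Fn] := Foo n; split; first exact: measurableX.
by rewrite [X in (X < _)%E]product_measure1E// lte_mul_pinfty// ge0_fin_numE.
Qed.

HB.instance Definition _ :=
  Measure_isSigmaFinite.Build _ _ _ lebesgue2 lebesgue2_sigma_finite.

Local Notation mu2 := lebesgue2.

Definition shift_line (b : R) : measurableTypeR R -> measurableTypeR R :=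
  fun x : R => x + b.

Lemma measurable_shift_line (b : R) : measurable_fun setT (shift_line b).
Proof. exact: measurable_funD. Qed.

(** The image measure gives every half-open interval its length, which characterises Lebesgue
    measure. *)
Lemma lebesgue_measure_shift (b : R) (A : set R) : measurable A ->
  pushforward mu (shift_line b) A = mu A.
Proof.
move=> mA; apply/esym/lebesgue_measure_unique => //=.
  exact: measurable_shift_line.
move=> _ _ [[x y]] _ <-; rewrite /pushforward.
rewrite (_ : _ @^-1` _ = `](x - b), (y - b)]%classic).
  rewrite !lebesgue_measure_itv/= !lte_fin ltrD2r; case: ifP => // _.
  by rewrite -!EFinB; congr EFin; ring.
by apply/seteqP; split => t /=; rewrite /shift_line !in_itv/= ltrBlDr lerBrDr.
Qed.

Lemma ge0_integral_shift (b : R) (f : R -> \bar R) :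
  measurable_fun [set: R] f -> (forall x, 0 <= f x)%E ->
  (\int[mu]_x f (x + b)%R = \int[mu]_x f x)%E.
Proof.
move=> mf f0; have mb := measurable_shift_line b.
transitivity (\int[pushforward mu (shift_line b)]_x f x)%E.
  by rewrite ge0_integral_pushforward.
by apply: eq_measure_integral => // A mA _; exact: lebesgue_measure_shift.
Qed.

Lemma ge0_integral_shift2 (b : K) (f : K -> \bar R) :
  measurable_fun [set: K] f -> (forall x, 0 <= f x)%E ->
  (\int[mu2]_z f (z.1 + b.1, z.2 + b.2)%R = \int[mu2]_z f z)%E.
Proof.
move=> mf f0.
have mshift : measurable_fun setT (fun z : K => (z.1 + b.1, z.2 + b.2) : K).
  by apply: measurable_fun_pair => /=; apply: measurable_funD => //.
rewrite /lebesgue2 (fubini_tonelli1 (fun z : K => f (z.1 + b.1, z.2 + b.2)))//=; last first.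
  exact: measurableT_comp mf mshift.
rewrite (fubini_tonelli1 f)// /fubini_F /=.
under eq_integral => x _.
  rewrite (@ge0_integral_shift b.2 (fun y => f (x + b.1, y)))//; last first.
    by apply: (measurableT_comp mf); exact: measurable_fun_pair.
  over.
rewrite (@ge0_integral_shift b.1 (fun x => \int[mu]_y f (x, y)))%E//.
- exact: measurable_fun_fubini_tonelli_F.
- by move=> x; exact: integral_ge0.
Qed.

End lebesgue_plane.

(** * Gaussian integrals *)

Section density.
Context d (T : measurableType d) (R : realType).
Variables (mu nu : {measure set T -> \bar R}) (p : T -> R).
Hypotheses (mp : measurable_fun setT p) (p0 : forall x, 0 <= p x).
Hypothesis nuE : forall A, measurable A -> nu A = (\int[mu]_(x in A) (p x)%:E)%E.
Import HBNNSimple.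
Local Open Scope ereal_scope.

Lemma nnsfun_integral_density (h : {nnsfun T >-> R}) :
  \int[nu]_x (h x)%:E = \int[mu]_x ((h x)%:E * (p x)%:E).
Proof.
have mEp : measurable_fun setT (EFin \o p) by exact/measurable_EFinP.
transitivity (\int[mu]_x (\sum_(y \in range h)
    (y * \1_(h @^-1` [set y]) x)%:E * (p x)%:E)); last first.
  apply: eq_integral => x xE.
  rewrite -ge0_mule_fsuml => [|y]; last exact: nnfun_muleindic_ge0.
  by rewrite fsumEFin // -(fimfunE _ x).
rewrite ge0_integral_fsum//; last 2 first.
  - move=> y; apply: emeasurable_funM => //.
    by apply/measurable_EFinP; exact: measurable_funM.
  - by move=> m y Ey; apply: mule_ge0; [exact: nnfun_muleindic_ge0|rewrite lee_fin].
rewrite integralT_nnsfun sintegralE.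
apply: eq_fsbigr => r rh.
transitivity (\int[mu]_x (r%:E * ((\1_(h @^-1` [set r]) x)%:E * (p x)%:E))).
  rewrite nuE// integral_mkcond epatch_indic/=.
  under eq_integral do rewrite muleC.
  rewrite ge0_integralZl//.
  - by apply: emeasurable_funM => //; apply/measurable_EFinP.
  - by move=> x _; rewrite mule_ge0 ?lee_fin.
  - by move: rh; rewrite inE => -[x _ <-]; rewrite lee_fin.
by apply: eq_integral => x _; rewrite EFinM muleA.
Qed.

(** Monotone convergence on both sides along the same simple approximation of [f]. *)
Lemma ge0_integral_density (f : T -> \bar R) :
  measurable_fun setT f -> (forall x, 0 <= f x) ->
  \int[nu]_x f x = \int[mu]_x (f x * (p x)%:E).
Proof.
move=> mf f0; pose h := nnsfun_approx measurableT mf.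
have -> : \int[nu]_x f x = lim ((\int[nu]_x (h n x)%:E) @[n --> \oo]).
  rewrite -monotone_convergence//.
  - by apply: eq_integral => x _; apply/esym/cvg_lim => //; exact: cvg_nnsfun_approx.
  - by move=> n; exact/measurable_EFinP.
  - by move=> n x _; rewrite lee_fin.
  - by move=> x _ a b ab; rewrite lee_fin; exact/lefP/nd_nnsfun_approx.
have -> : \int[mu]_x (f x * (p x)%:E) =
    lim ((\int[mu]_x ((h n x)%:E * (p x)%:E)) @[n --> \oo]).
  rewrite -monotone_convergence//.
  - apply: eq_integral => x _; apply/esym/cvg_lim => //; apply: cvgeZr => //.
    exact: cvg_nnsfun_approx.
  - by move=> n; apply: emeasurable_funM; exact/measurable_EFinP.
  - by move=> n x _; rewrite mule_ge0 ?lee_fin.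
  - move=> x _ a b ab; rewrite lee_wpmul2r ?lee_fin//.
    exact/lefP/nd_nnsfun_approx.
by under eq_fun do rewrite nnsfun_integral_density.
Qed.

End density.

Section gaussian.
Context (R : realType).
Local Notation mu := (@lebesgue_measure R).
Local Notation K := (measurableTypeR R * measurableTypeR R)%type.
Local Notation mu2 := (mu \x mu)%E.

Lemma half_stddev : Num.sqrt 2^-1 ^+ 2 = 2^-1 :> R.
Proof. by rewrite sqr_sqrtr// invr_ge0. Qed.

Lemma half_stddev_neq0 : Num.sqrt 2^-1 != 0 :> R.
Proof. by rewrite gt_eqF// sqrtr_gt0 invr_gt0. Qed.

Definition half_normal : probability (measurableTypeR R) R :=
  normal_prob 0 (Num.sqrt 2^-1).

(** With variance 1/2 the quantity 2 sigma^2 is 1, which simplifies both the peak and the exponent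
    of the normal density. *)
Definition half_pdf (x : R) : R := (Num.sqrt pi)^-1 * expR (- x ^+ 2).

Lemma half_pdfE x : normal_pdf 0 (Num.sqrt 2^-1) x = half_pdf x.
Proof.
rewrite normal_pdfE ?half_stddev_neq0// /normal_peak /normal_fun half_stddev.
rewrite /half_pdf subr0; congr ((Num.sqrt _)^-1 * expR _).
  by field.
by field.
Qed.

Lemma half_pdf_ge0 x : 0 <= half_pdf x.
Proof. by rewrite -half_pdfE normal_pdf_ge0. Qed.

Lemma measurable_half_pdf : measurable_fun [set: R] half_pdf.
Proof.
rewrite (_ : half_pdf = normal_pdf 0 (Num.sqrt 2^-1)).
  exact: measurable_normal_pdf.
by apply/funext => x; rewrite half_pdfE.
Qed.

Lemma ge0_integral_half_normal (f : R -> \bar R) :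
  measurable_fun [set: R] f -> (forall x, 0 <= f x)%E ->
  (\int[half_normal]_x f x = \int[mu]_x (f x * (half_pdf x)%:E))%E.
Proof.
move=> mf f0; apply: ge0_integral_density => //.
- exact: measurable_half_pdf.
- exact: half_pdf_ge0.
- move=> A mA; rewrite /half_normal/= /normal_prob.
  by apply: eq_integral => x _; rewrite half_pdfE.
Qed.

Lemma laplace_half_normal (c : R) : 0 <= c ->
  (\int[half_normal]_x (expR (- (c * x ^+ 2)))%:E =
   ((Num.sqrt (1 + c))^-1)%:E)%E.
Proof.
move=> c0; have c1 : 0 < 1 + c by lra.
have mexp : measurable_fun [set: R] (fun x => expR (- (c * x ^+ 2))).
  by apply: measurableT_comp => //; apply: measurableT_comp => //;
    apply: measurable_funM => //; exact: measurable_funX.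
rewrite ge0_integral_half_normal//; last exact/measurable_EFinP.
(* The tilted density is, up to the factor (1 + c)^(-1/2), the normal density of variance 1 / (2 (1
   + c)). *)
pose s : R := Num.sqrt (2 * (1 + c))^-1.
have s2 : s ^+ 2 = (2 * (1 + c))^-1.
  by rewrite sqr_sqrtr// invr_ge0 mulr_ge0// ltW.
have s0 : s != 0 by rewrite gt_eqF// sqrtr_gt0 invr_gt0 mulr_gt0.
transitivity (\int[mu]_x
   (((Num.sqrt (1 + c))^-1)%:E * (normal_pdf 0 s x)%:E))%E; last first.
  rewrite ge0_integralZl//= ?integral_normal_pdf ?mule1//.
  - by apply/measurable_EFinP; exact: measurable_normal_pdf.
  - by move=> x _; exact: normal_pdf_ge0.
apply: eq_integral => x _; rewrite -!EFinM; congr EFin.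
rewrite normal_pdfE// /normal_peak /normal_fun s2 /half_pdf subr0.
rewrite mulrCA -expRD !mulrA; congr (_ * expR _); last first.
  by field; rewrite gt_eqF.
rewrite -invfM -sqrtrM ?ltW//; congr (Num.sqrt _)^-1.
by rewrite mulrnAr; field; rewrite gt_eqF.
Qed.

End gaussian.

(** * Complex-valued measurable functions *)

Section complex_measurability.
Context (R : realType).

Definition cplx (z : R * R) : R[i] := (z.1 +i* z.2)%C.

Lemma cplxK : cancel cplx (@plane_of_complex R).
Proof. by case. Qed.

Lemma plane_of_complexK : cancel (@plane_of_complex R) cplx.
Proof. by case. Qed.

(** Unlike the norm of [R[i]], which is again complex, this is a real number and a polynomial in the
    two parts, convenient for measurability and for [ring]. *)
Definition normc2 (z : R[i]) : R := complex.Re z ^+ 2 + complex.Im z ^+ 2.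

Lemma normc2_ge0 z : 0 <= normc2 z.
Proof. by rewrite addr_ge0// sqr_ge0. Qed.

Lemma normc2M z w : normc2 (z * w) = normc2 z * normc2 w.
Proof. by case: z w => [a b] [c e]; rewrite /normc2/=; ring. Qed.

Lemma normc2_eq0 z : (normc2 z == 0) = (z == 0).
Proof.
case: z => a b; rewrite /normc2/= paddr_eq0 ?sqr_ge0// !sqrf_eq0.
by rewrite eq_complex.
Qed.

Context d (T : measurableType d).
Implicit Types f g : T -> R[i].

Definition cmeasurable f := measurable_fun setT (@plane_of_complex R \o f).

Lemma cmeasurableP f : cmeasurable f <->
  measurable_fun setT (fun x => complex.Re (f x)) /\
  measurable_fun setT (fun x => complex.Im (f x)).
Proof.
split=> [mf|[mr mi]]; last exact: measurable_fun_pair.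
split.
- by have := measurableT_comp (@measurable_fst _ _ _ _) mf.
- by have := measurableT_comp (@measurable_snd _ _ _ _) mf.
Qed.

Lemma cmeasurable_cst c : cmeasurable (fun=> c).
Proof. exact: measurable_cst. Qed.

Lemma cmeasurable_cplx (f : T -> R * R) :
  measurable_fun setT f -> cmeasurable (fun x => cplx (f x)).
Proof.
by move=> mf; rewrite /cmeasurable (_ : _ \o _ = f)//; apply/funext => x /=; case: (f x).
Qed.

Lemma cmeasurableD f g : cmeasurable f -> cmeasurable g ->
  cmeasurable (fun x => f x + g x).
Proof.
move=> /cmeasurableP[fr fi] /cmeasurableP[gr gi]; apply/cmeasurableP; split.
- rewrite (_ : (fun _ => _) = (fun x => complex.Re (f x) + complex.Re (g x))).
    exact: measurable_funD.
  by apply/funext => x; case: (f x) (g x) => [? ?] [].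
- rewrite (_ : (fun _ => _) = (fun x => complex.Im (f x) + complex.Im (g x))).
    exact: measurable_funD.
  by apply/funext => x; case: (f x) (g x) => [? ?] [].
Qed.

Lemma cmeasurableM f g : cmeasurable f -> cmeasurable g ->
  cmeasurable (fun x => f x * g x).
Proof.
move=> /cmeasurableP[fr fi] /cmeasurableP[gr gi]; apply/cmeasurableP; split.
- rewrite (_ : (fun _ => _) = (fun x => complex.Re (f x) * complex.Re (g x) -
      complex.Im (f x) * complex.Im (g x))).
    by apply: measurable_funB; exact: measurable_funM.
  by apply/funext => x; case: (f x) (g x) => [? ?] [].
- rewrite (_ : (fun _ => _) = (fun x => complex.Re (f x) * complex.Im (g x) +
      complex.Im (f x) * complex.Re (g x))).
    by apply: measurable_funD; exact: measurable_funM.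
  by apply/funext => x; case: (f x) (g x) => [? ?] [].
Qed.

Lemma cmeasurable_sum (I : Type) (s : seq I) (P : pred I) (F : I -> T -> R[i]) :
  (forall i, cmeasurable (F i)) ->
  cmeasurable (fun x => \sum_(i <- s | P i) F i x).
Proof.
move=> mF; elim: s => [|i s IH].
  by under [X in cmeasurable X]eq_fun do rewrite big_nil; exact: cmeasurable_cst.
under [X in cmeasurable X]eq_fun do rewrite big_cons.
by case: (P i) => //; exact: cmeasurableD.
Qed.

Lemma cmeasurable_prod (I : Type) (s : seq I) (P : pred I) (F : I -> T -> R[i]) :
  (forall i, cmeasurable (F i)) ->
  cmeasurable (fun x => \prod_(i <- s | P i) F i x).
Proof.
move=> mF; elim: s => [|i s IH].
  by under [X in cmeasurable X]eq_fun do rewrite big_nil; exact: cmeasurable_cst.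
under [X in cmeasurable X]eq_fun do rewrite big_cons.
by case: (P i) => //; exact: cmeasurableM.
Qed.

Lemma cmeasurable_det n (F : T -> 'M[R[i]]_n) :
  (forall i j, cmeasurable (fun x => F x i j)) ->
  cmeasurable (fun x => \det (F x)).
Proof.
move=> mF; apply: cmeasurable_sum => s; apply: cmeasurableM.
  exact: cmeasurable_cst.
by apply: cmeasurable_prod => i; exact: mF.
Qed.

Lemma measurable_normc2 f : cmeasurable f ->
  measurable_fun setT (fun x => normc2 (f x)).
Proof.
by move=> /cmeasurableP[fr fi]; apply: measurable_funD; exact: measurable_funX.
Qed.

End complex_measurability.

Section complex_gaussian_measure.
Context (R : realType).
Local Notation mu := (@lebesgue_measure R).
Local Notation K := (measurableTypeR R * measurableTypeR R)%type.
Local Notation mu2 := (@lebesgue2 R).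
Local Notation pl := (@plane_of_complex R).

Definition cgauss : probability K R :=
  (@half_normal R \x @half_normal R)%E.

Definition cpdf (z : R * R) : R := half_pdf z.1 * half_pdf z.2.

(** The density depends on the modulus only: this is the source of unitary invariance. *)
Lemma cpdfE z : cpdf z = (Num.sqrt pi)^-1 ^+ 2 * expR (- normc2 (cplx z)).
Proof. by rewrite /cpdf /half_pdf /normc2/= opprD expRD; ring. Qed.

Lemma cpdf_ge0 z : 0 <= cpdf z.
Proof. by rewrite mulr_ge0// half_pdf_ge0. Qed.

Lemma measurable_cpdf : measurable_fun [set: K] cpdf.
Proof.
by apply: measurable_funM; apply: measurableT_comp => //; exact: measurable_half_pdf.
Qed.

Lemma ge0_integral_cgauss (f : K -> \bar R) :
  measurable_fun [set: K] f -> (forall x, 0 <= f x)%E ->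
  (\int[cgauss]_z f z = \int[mu2]_z (f z * (cpdf z)%:E))%E.
Proof.
move=> mf f0.
have mp := @measurable_half_pdf R.
have mfx x : measurable_fun [set: R] (fun y => f (x, y)).
  by apply: (measurableT_comp mf); exact: measurable_fun_pair.
rewrite (fubini_tonelli1 f)//.
rewrite /lebesgue2 (fubini_tonelli1 (fun z => f z * (cpdf z)%:E))%E//; last 2 first.
- by apply: emeasurable_funM => //; apply/measurable_EFinP; exact: measurable_cpdf.
- by move=> x; rewrite mule_ge0// lee_fin cpdf_ge0.
rewrite ge0_integral_half_normal//; last 2 first.
- exact: measurable_fun_fubini_tonelli_F.
- by move=> x; exact: integral_ge0.
apply: eq_integral => x _; rewrite /fubini_F/= ge0_integral_half_normal//.
rewrite -ge0_integralZr//; last 3 first.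
- by apply: emeasurable_funM; [exact: mfx|exact/measurable_EFinP].
- by move=> y _; rewrite mule_ge0// lee_fin half_pdf_ge0.
- by rewrite lee_fin half_pdf_ge0.
by apply: eq_integral => y _; rewrite /cpdf/= (EFinM (half_pdf x)) muleA muleAC.
Qed.

Lemma laplace_cgauss (c : R) : 0 <= c ->
  (\int[cgauss]_z (expR (- (c * normc2 (cplx z))))%:E = ((1 + c)^-1)%:E)%E.
Proof.
move=> c0; have c1 : 0 < 1 + c by lra.
have me : measurable_fun [set: R] (fun x => expR (- (c * x ^+ 2))).
  by apply: measurableT_comp => //; apply: measurableT_comp => //;
    apply: measurable_funM => //; exact: measurable_funX.
rewrite (_ : (fun _ => _) = fun z : K =>
  ((expR (- (c * z.1 ^+ 2)))%:E * (expR (- (c * z.2 ^+ 2)))%:E)%E); last first.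
  by apply/funext => z; rewrite -EFinM -expRD /normc2/=; congr (expR _)%:E; ring.
rewrite fubini_tonelli1//; last first.
- by apply: emeasurable_funM => //; apply/measurable_EFinP;
    apply: (measurableT_comp me).
rewrite /fubini_F/=.
under eq_integral => x _.
  rewrite ge0_integralZl//=; last exact/measurable_EFinP.
  rewrite laplace_half_normal//.
  over.
rewrite ge0_integralZr//=; last exact/measurable_EFinP.
rewrite laplace_half_normal// -EFinM -invfM -expr2 sqr_sqrtr//.
exact: ltW.
Qed.

End complex_gaussian_measure.

(** * Unitary invariance of the Gaussian law *)

Section givens.
Context (R : realType).
Local Notation mu := (@lebesgue_measure R).
Local Notation K := (measurableTypeR R * measurableTypeR R)%type.
Local Notation mu2 := (@lebesgue2 R).
Local Notation mu4 := (mu2 \x mu2)%E.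
Local Notation pl := (@plane_of_complex R).
Implicit Types (a c p : R[i]) (q : K * K).

Definition pairc d (T : measurableType d) (f g : T -> R[i]) : T -> K * K :=
  fun x => (pl (f x), pl (g x)).

Lemma measurable_pairc d (T : measurableType d) (f g : T -> R[i]) :
  cmeasurable f -> cmeasurable g -> measurable_fun setT (pairc f g).
Proof. by move=> mf mg; exact: measurable_fun_pair. Qed.

Lemma cmeasurable_fst : cmeasurable (fun q => cplx q.1).
Proof. exact: cmeasurable_cplx. Qed.

Lemma cmeasurable_snd : cmeasurable (fun q => cplx q.2).
Proof. exact: cmeasurable_cplx. Qed.

Definition upper_shear p : K * K -> K * K :=
  pairc (fun q => cplx q.1 + p * cplx q.2) (fun q => cplx q.2).

Definition lower_shear p : K * K -> K * K :=
  pairc (fun q => cplx q.1) (fun q => cplx q.2 + p * cplx q.1).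

Lemma measurable_upper_shear p : measurable_fun setT (upper_shear p).
Proof.
apply: measurable_pairc; last exact: cmeasurable_snd.
apply: cmeasurableD; first exact: cmeasurable_fst.
by apply: cmeasurableM; [exact: cmeasurable_cst|exact: cmeasurable_snd].
Qed.

Lemma measurable_lower_shear p : measurable_fun setT (lower_shear p).
Proof.
apply: measurable_pairc; first exact: cmeasurable_fst.
apply: cmeasurableD; first exact: cmeasurable_snd.
by apply: cmeasurableM; [exact: cmeasurable_cst|exact: cmeasurable_fst].
Qed.

Lemma plane_of_complexD (z : K) (b : R[i]) :
  pl (cplx z + b) = (z.1 + (pl b).1, z.2 + (pl b).2) :> K.
Proof. by case: z b => ? ? []. Qed.

(** For a fixed second coordinate the shear translates the first one, so integrating the first
    coordinate innermost reduces the claim to [ge0_integral_shift2]. *)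
Lemma ge0_integral_upper_shear p (f : K * K -> \bar R) :
  measurable_fun setT f -> (forall x, 0 <= f x)%E ->
  (\int[mu4]_q f (upper_shear p q) = \int[mu4]_q f q)%E.
Proof.
move=> mf f0.
rewrite (fubini_tonelli2 (fun q => f (upper_shear p q)))//; last first.
  exact: measurableT_comp mf (measurable_upper_shear p).
rewrite (fubini_tonelli2 f)//.
apply: eq_integral => w _; rewrite /fubini_G/=.
transitivity (\int[mu2]_z (fun z : K => f (z, w))
    (z.1 + (pl (p * cplx w)).1, z.2 + (pl (p * cplx w)).2)%R)%E.
  apply: eq_integral => z _.
  by rewrite /upper_shear/pairc/= plane_of_complexD cplxK.
rewrite (@ge0_integral_shift2 R (pl (p * cplx w)) (fun z : K => f (z, w)))//.
by apply: (measurableT_comp mf); exact: measurable_fun_pair.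
Qed.

Lemma ge0_integral_lower_shear p (f : K * K -> \bar R) :
  measurable_fun setT f -> (forall x, 0 <= f x)%E ->
  (\int[mu4]_q f (lower_shear p q) = \int[mu4]_q f q)%E.
Proof.
move=> mf f0.
rewrite (fubini_tonelli1 (fun q => f (lower_shear p q)))//; last first.
  exact: measurableT_comp mf (measurable_lower_shear p).
rewrite (fubini_tonelli1 f)//.
apply: eq_integral => z _; rewrite /fubini_F/=.
transitivity (\int[mu2]_w (fun w : K => f (z, w))
    (w.1 + (pl (p * cplx z)).1, w.2 + (pl (p * cplx z)).2)%R)%E.
  apply: eq_integral => w _.
  by rewrite /lower_shear/pairc/= plane_of_complexD cplxK.
rewrite (@ge0_integral_shift2 R (pl (p * cplx z)) (fun w : K => f (z, w)))//.
by apply: (measurableT_comp mf); exact: measurable_fun_pair.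
Qed.

(** When [normc2 a + normc2 c = 1], this is the action on row vectors of an element of SU(2). *)
Definition givens a c : K * K -> K * K :=
  pairc (fun q => a * cplx q.1 + c * cplx q.2)
        (fun q => - (c^*)%C * cplx q.1 + (a^*)%C * cplx q.2).

Lemma measurable_givens a c : measurable_fun setT (givens a c).
Proof.
have mfs b : cmeasurable (fun q => b * cplx q.1).
  by apply: cmeasurableM; [exact: cmeasurable_cst|exact: cmeasurable_fst].
have msn b : cmeasurable (fun q => b * cplx q.2).
  by apply: cmeasurableM; [exact: cmeasurable_cst|exact: cmeasurable_snd].
by apply: measurable_pairc; exact: cmeasurableD.
Qed.

Lemma mulCC_normc2 a : a * (a^*)%C = (normc2 a)%:C%C.
Proof.
by case: a => x y; apply/eqP; rewrite eq_complex /normc2/=;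
  apply/andP; split; apply/eqP; ring.
Qed.

(* A Givens rotation is a product of three shears, each of which preserves
   Lebesgue measure by translation invariance. *)
Lemma givens_shears a c q : c != 0 -> normc2 a + normc2 c = 1 ->
  givens a c q = upper_shear ((1 - a) / (c^*)%C)
    (lower_shear (- (c^*)%C) (upper_shear ((1 - (a^*)%C) / (c^*)%C) q)).
Proof.
move=> c0 ac1; have cc0 : (c^*)%C != 0 by rewrite conjc_eq0.
have ac : c * (c^*)%C = 1 - a * (a^*)%C.
  have <- : (normc2 a)%:C%C + (normc2 c)%:C%C = 1 by rewrite -rmorphD/= ac1.
  by rewrite !mulCC_normc2 addrC addKr.
rewrite /givens /upper_shear /lower_shear /pairc /= !plane_of_complexK.
(* To [field], [a], [c] and their conjugates are independent atoms; the unit-norm relation enters by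
   eliminating [c]. *)
have cE : c = (1 - a * (a^*)%C) / (c^*)%C by rewrite -ac mulfK.
congr (pl _, pl _); last by field.
by rewrite [X in _ + X * _ = _]cE; field.
Qed.

Lemma normc2_givens a c q : normc2 a + normc2 c = 1 ->
  normc2 (cplx (givens a c q).1) + normc2 (cplx (givens a c q).2) =
  normc2 (cplx q.1) + normc2 (cplx q.2).
Proof.
move=> ac1; rewrite -[RHS]mul1r -ac1 /givens /pairc /= !plane_of_complexK.
case: a c q {ac1} => [a1 a2] [c1 c2] [[z1 z2] [w1 w2]].
by rewrite /normc2/=; ring.
Qed.

Lemma ge0_integral_cgauss2 (f : K * K -> \bar R) :
  measurable_fun setT f -> (forall x, 0 <= f x)%E ->
  (\int[cgauss R \x cgauss R]_q f q =
   \int[mu4]_q (f q * (cpdf q.1 * cpdf q.2)%:E))%E.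
Proof.
move=> mf f0.
have mp := @measurable_cpdf R.
have mp1 : measurable_fun setT (fun q : K * K => cpdf q.1).
  by apply: (measurableT_comp mp).
have mp2 : measurable_fun setT (fun q : K * K => cpdf q.2).
  by apply: (measurableT_comp mp).
have mfx x : measurable_fun [set: K] (fun y => f (x, y)).
  by apply: (measurableT_comp mf); exact: measurable_fun_pair.
rewrite (fubini_tonelli1 f)//.
rewrite (fubini_tonelli1 (fun q => f q * (cpdf q.1 * cpdf q.2)%:E))%E//; last 2 first.
- apply: emeasurable_funM => //; apply/measurable_EFinP; exact: measurable_funM.
- by move=> x; rewrite mule_ge0// lee_fin mulr_ge0// cpdf_ge0.
rewrite ge0_integral_cgauss//; last 2 first.
- exact: measurable_fun_fubini_tonelli_F.
- by move=> x; exact: integral_ge0.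
apply: eq_integral => x _; rewrite /fubini_F/= ge0_integral_cgauss//.
rewrite -ge0_integralZr//; last 3 first.
- by apply: emeasurable_funM; [exact: mfx|exact/measurable_EFinP].
- by move=> y _; rewrite mule_ge0// lee_fin cpdf_ge0.
- by rewrite lee_fin cpdf_ge0.
by apply: eq_integral => y _; rewrite (EFinM (cpdf x)) muleA muleAC.
Qed.

Lemma ge0_integral_givens a c (f : K * K -> \bar R) :
  c != 0 -> normc2 a + normc2 c = 1 ->
  measurable_fun setT f -> (forall x, 0 <= f x)%E ->
  (\int[cgauss R \x cgauss R]_q f (givens a c q) =
   \int[cgauss R \x cgauss R]_q f q)%E.
Proof.
move=> c0 ac1 mf f0.
have mfg : measurable_fun setT (fun q => f (givens a c q)).
  exact: measurableT_comp mf (measurable_givens a c).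
rewrite (ge0_integral_cgauss2 mfg (fun q => f0 (givens a c q))).
rewrite (ge0_integral_cgauss2 mf f0).
pose h q := (f q * (cpdf q.1 * cpdf q.2)%:E)%E.
have mh : measurable_fun setT h.
  apply: emeasurable_funM => //; apply/measurable_EFinP; apply: measurable_funM.
  - by apply: (measurableT_comp (@measurable_cpdf R)).
  - by apply: (measurableT_comp (@measurable_cpdf R)).
have h0 q : (0 <= h q)%E by rewrite mule_ge0// lee_fin mulr_ge0// cpdf_ge0.
(* The joint density is a function of the total squared norm, which [givens] preserves; it can
   therefore be evaluated at the rotated point, and only Lebesgue measure remains to be
   transported. *)
transitivity (\int[mu4]_q h (givens a c q))%E.
  apply: eq_integral => q _; rewrite /h; congr (_ * _%:E)%E.
  rewrite !cpdfE mulrACA -expRD -opprD -(normc2_givens q ac1) opprD expRD.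
  by rewrite mulrACA.
under eq_integral => q _ do rewrite givens_shears//.
set p1 := (1 - (a^*)%C) / (c^*)%C; set p2 := (1 - a) / (c^*)%C.
have m2 : measurable_fun setT (fun q => h (upper_shear p2 q)).
  exact: measurableT_comp mh (measurable_upper_shear p2).
have m1 : measurable_fun setT (fun q => h (upper_shear p2 (lower_shear (- (c^*)%C) q))).
  exact: measurableT_comp m2 (measurable_lower_shear _).
etransitivity; first exact: (ge0_integral_upper_shear p1 m1 (fun q => h0 _)).
etransitivity; first exact: (ge0_integral_lower_shear (- (c^*)%C) m2 (fun q => h0 _)).
exact: ge0_integral_upper_shear.
Qed.

End givens.

Section tprod_map.
Context d d' (T : measurableType d) (T' : measurableType d') (R : realType).
Variables (nu : probability T R) (nu' : probability T' R) (f : T -> T').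
Hypotheses (mf : measurable_fun setT f).
Hypothesis nuf : forall A, measurable A -> nu (f @^-1` A) = nu' A.

Lemma measurable_map_tuple n : measurable_fun setT (@map_tuple n _ _ f).
Proof.
apply/measurable_fun_tnthP => i.
rewrite (_ : _ \o _ = f \o (fun x : n.-tuple T => tnth x i)).
  exact: measurableT_comp mf (measurable_tnth i).
by apply/funext => x /=; rewrite tnth_map.
Qed.

(** Later [f] acts on the rows of a matrix, either rotating each row or deleting its first entry. *)
Lemma tprod_map n (A : set (n.-tuple T')) : measurable A ->
  tprod nu n (@map_tuple n _ _ f @^-1` A) = tprod nu' n A.
Proof.
move=> mA; apply/esym.
change (tprod nu' n A = law (tprod nu n) (@measurable_map_tuple n) A).
apply: (@tuple_measure_unique _ T' R n measurable (tprod nu' n)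
  (law (tprod nu n) (@measurable_map_tuple n))) => //.
- exact: measurableI.
- by rewrite sigma_algebra_id//; exact: sigma_algebra_measurable.
move=> B mB; rewrite tprod_box//.
under eq_bigr => i _ do rewrite -nuf//.
have mfB i : measurable (f @^-1` B i).
  by rewrite -[X in measurable X]setTI; exact: mf.
etransitivity; first exact/esym/(tprod_box nu mfB).
by congr (tprod nu n _); apply/seteqP; split=> x /= xB i;
  have := xB i; rewrite tnth_map.
Qed.

End tprod_map.

Section rotation.
Context (R : realType).
Local Notation K := (measurableTypeR R * measurableTypeR R)%type.
Local Notation pl := (@plane_of_complex R).

Definition row_of_tuple n (x : n.-tuple K) : 'rV[R[i]]_n := \row_j cplx (tnth x j).

Definition tuple_of_row n (v : 'rV[R[i]]_n) : n.-tuple K := [tuple pl (v 0 j) | j < n].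

Lemma row_of_tupleK n : cancel (@row_of_tuple n) (@tuple_of_row n).
Proof.
by move=> x; apply: eq_from_tnth => j; rewrite tnth_mktuple mxE cplxK.
Qed.

Lemma tuple_of_rowK n : cancel (@tuple_of_row n) (@row_of_tuple n).
Proof.
by move=> v; apply/rowP => j; rewrite mxE tnth_mktuple plane_of_complexK.
Qed.

Lemma row_of_tuple_cons n (z : K) (x : n.-tuple K) :
  row_of_tuple [tuple of z :: x] = row_mx (cplx z)%:M (row_of_tuple x) :> 'rV_(1 + n).
Proof.
apply/rowP => j; rewrite mxE; case: (split_ordP j) => k ->.
  by rewrite row_mxEl !mxE ord1 eqxx mulr1n (tnth_nth z).
by rewrite row_mxEr !mxE !(tnth_nth z).
Qed.

Definition rotate n (U : 'M[R[i]]_n) (x : n.-tuple K) : n.-tuple K := tuple_of_row (row_of_tuple x *m U).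

Lemma row_of_rotate n (U : 'M[R[i]]_n) x : row_of_tuple (rotate U x) = row_of_tuple x *m U.
Proof. by rewrite tuple_of_rowK. Qed.

Lemma rotateM n (U V : 'M[R[i]]_n) x : rotate (U *m V) x = rotate V (rotate U x).
Proof. by rewrite /rotate tuple_of_rowK mulmxA. Qed.

Lemma rotate1 n x : rotate (1%:M : 'M[R[i]]_n) x = x.
Proof. by rewrite /rotate mulmx1 row_of_tupleK. Qed.

Lemma measurable_rotate n (U : 'M[R[i]]_n) : measurable_fun setT (rotate U).
Proof.
apply/measurable_fun_tnthP => j.
have : cmeasurable (fun x : n.-tuple K => (row_of_tuple x *m U) 0 j).
  under [X in cmeasurable X]eq_fun do rewrite mxE.
  apply: cmeasurable_sum => k; apply: cmeasurableM; last exact: cmeasurable_cst.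
  under [X in cmeasurable X]eq_fun do rewrite mxE.
  by apply: cmeasurable_cplx; exact: measurable_tnth.
rewrite /cmeasurable; congr (measurable_fun _ _).
by apply/funext => x /=; rewrite tnth_mktuple.
Qed.

Definition gauss_row n : probability (n.-tuple K) R := tprod (cgauss R) n.

(** The recursion on determinants uses unitarity only through this invariance and through
    [normc2 (\det U) = 1]. *)
Definition gauss_invariant n (U : 'M[R[i]]_n) :=
  forall A, measurable A -> gauss_row n (rotate U @^-1` A) = gauss_row n A.

Lemma measurable_rotate_preimage n (U : 'M[R[i]]_n) A :
  measurable A -> measurable (rotate U @^-1` A).
Proof. by move=> mA; rewrite -[X in measurable X]setTI; exact: measurable_rotate. Qed.

Lemma gauss_invariant1 n : gauss_invariant (1%:M : 'M[R[i]]_n).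
Proof.
move=> A mA; congr (gauss_row n _).
by apply/seteqP; split => x; rewrite /preimage/= rotate1.
Qed.

Lemma gauss_invariantM n (U V : 'M[R[i]]_n) :
  gauss_invariant U -> gauss_invariant V -> gauss_invariant (U *m V).
Proof.
move=> gU gV A mA; rewrite -(gV A)// -(gU (rotate V @^-1` A)); last first.
  exact: measurable_rotate_preimage.
by congr (gauss_row n _); apply/seteqP; split => x; rewrite /preimage/= rotateM.
Qed.

Lemma measurable_cons_section n (A : set (n.+1.-tuple K)) (z : K) :
  measurable A -> measurable [set x : n.-tuple K | A [tuple of z :: x]].
Proof.
move=> mA; rewrite -[X in measurable X]setTI.
by apply: (@measurable_cons _ _ _ _ (fun=> z) n id) => //.
Qed.

Definition block1 n (U : 'M[R[i]]_n) : 'M[R[i]]_n.+1 :=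
  block_mx (1%:M : 'M[R[i]]_1) 0 0 U.

Lemma rotate_block1 n (U : 'M[R[i]]_n) (z : K) (x : n.-tuple K) :
  rotate (block1 U) [tuple of z :: x] = [tuple of z :: rotate U x].
Proof.
apply: (can_inj (@row_of_tupleK _)); rewrite row_of_rotate !row_of_tuple_cons row_of_rotate.
etransitivity; first exact: (@mul_row_block _ 1 1 n 1 n).
by rewrite !mulmx0 mulmx1 addr0 add0r.
Qed.

Lemma det_block1 n (U : 'M[R[i]]_n) : \det (block1 U) = \det U.
Proof.
by etransitivity; [exact: (@det_ublock _ 1 n)|rewrite det1 mul1r].
Qed.

Lemma gauss_invariant_block1 n (U : 'M[R[i]]_n) :
  gauss_invariant U -> gauss_invariant (block1 U).
Proof.
move=> gU A mA; rewrite /gauss_row !tprodS; apply: eq_integral => z _.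
rewrite -(gU [set x : n.-tuple K | A [tuple of z :: x]]); last exact: measurable_cons_section.
by congr (gauss_row n _); apply/seteqP; split => x; rewrite /preimage/= rotate_block1.
Qed.

(** Matrices act on row vectors from the right, so adding [p] times the second coordinate to the
    first places [p] below the diagonal. *)
Definition upper_shear_mx n (p : R[i]) : 'M[R[i]]_n.+2 :=
  block_mx (1%:M : 'M[R[i]]_1) 0 (col_mx (p%:M : 'M[R[i]]_1) 0 : 'M[R[i]]_(1 + n, 1)) 1%:M.

Definition lower_shear_mx n (p : R[i]) : 'M[R[i]]_n.+2 :=
  block_mx (1%:M : 'M[R[i]]_1) (row_mx (p%:M : 'M[R[i]]_1) 0 : 'M[R[i]]_(1, 1 + n)) 0 1%:M.

Lemma rotate_upper_shear n p (q : K * K) (x : n.-tuple K) :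
  rotate (upper_shear_mx n p) [tuple of q.1 :: [tuple of q.2 :: x]] =
  [tuple of (upper_shear p q).1 :: [tuple of (upper_shear p q).2 :: x]].
Proof.
apply: (can_inj (@row_of_tupleK _)); rewrite row_of_rotate !row_of_tuple_cons.
etransitivity; first exact: (@mul_row_block _ 1 1 n.+1 1 n.+1).
rewrite mulmx0 !mulmx1 add0r.
have E : row_mx (cplx q.2)%:M (row_of_tuple x) *m col_mx (p%:M : 'M[R[i]]_1) 0 =
    (cplx q.2 * p)%:M :> 'M[R[i]]_1.
  by rewrite mul_row_col mulmx0 addr0 -scalar_mxM.
rewrite !plane_of_complexK; apply: (f_equal2 (@row_mx _ 1 1 n.+1)) => //.
etransitivity; first by apply: (f_equal2 +%R erefl); exact: E.
by rewrite -raddfD/= (mulrC (cplx q.2)).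
Qed.

Lemma rotate_lower_shear n p (q : K * K) (x : n.-tuple K) :
  rotate (lower_shear_mx n p) [tuple of q.1 :: [tuple of q.2 :: x]] =
  [tuple of (lower_shear p q).1 :: [tuple of (lower_shear p q).2 :: x]].
Proof.
apply: (can_inj (@row_of_tupleK _)); rewrite row_of_rotate !row_of_tuple_cons.
etransitivity; first exact: (@mul_row_block _ 1 1 n.+1 1 n.+1).
rewrite mulmx0 !mulmx1 addr0.
have E : (cplx q.1)%:M *m row_mx (p%:M : 'M[R[i]]_1) 0 + row_mx (cplx q.2)%:M (row_of_tuple x) =
    row_mx (cplx q.2 + p * cplx q.1)%:M (row_of_tuple x) :> 'rV[R[i]]_(1 + n).
  rewrite mul_mx_row mulmx0 add_row_mx add0r -scalar_mxM -raddfD/=.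
  by rewrite (mulrC (cplx q.1)) addrC.
by rewrite !plane_of_complexK; apply: (f_equal2 (@row_mx _ 1 1 n.+1)) => //.
Qed.

(** Written as a product of shears, it has determinant 1 by triangularity. The factors come in the
    reverse order of [givens_shears], because in a right action the leftmost factor acts first. *)
Definition givens_mx n (a c : R[i]) : 'M[R[i]]_n.+2 :=
  upper_shear_mx n ((1 - (a^*)%C) / (c^*)%C) *m lower_shear_mx n (- (c^*)%C)
  *m upper_shear_mx n ((1 - a) / (c^*)%C).

Lemma det_givens_mx n a c : \det (givens_mx n a c) = 1.
Proof.
have dU p : \det (upper_shear_mx n p) = 1.
  by etransitivity; [exact: (@det_lblock _ 1 n.+1)|rewrite !det1 mulr1].
have dL p : \det (lower_shear_mx n p) = 1.
  by etransitivity; [exact: (@det_ublock _ 1 n.+1)|rewrite !det1 mulr1].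
by rewrite !det_mulmx !dU dL !mulr1.
Qed.

Lemma rotate_givens n a c (q : K * K) (x : n.-tuple K) :
  c != 0 -> normc2 a + normc2 c = 1 ->
  rotate (givens_mx n a c) [tuple of q.1 :: [tuple of q.2 :: x]] =
  [tuple of (givens a c q).1 :: [tuple of (givens a c q).2 :: x]].
Proof.
move=> c0 ac1; rewrite !rotateM rotate_upper_shear rotate_lower_shear rotate_upper_shear.
by rewrite givens_shears.
Qed.

(** Isolates the two coordinates that a Givens rotation moves; returning [g] as a witness carries
    its measurability along. *)
Lemma gauss_rowSS n (A : set (n.+2.-tuple K)) : measurable A ->
  exists g : K * K -> \bar R, [/\ measurable_fun setT g,
    (forall q, g q = gauss_row n [set x : n.-tuple K | A [tuple of q.1 :: [tuple of q.2 :: x]]]) &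
    gauss_row n.+2 A = (\int[cgauss R \x cgauss R]_q g q)%E].
Proof.
move=> mA.
pose c2 (qx : (K * K) * n.-tuple K) : n.+2.-tuple K :=
  [tuple of qx.1.1 :: [tuple of qx.1.2 :: qx.2]].
have mc2 : measurable_fun setT c2.
  apply: measurable_cons; first by apply: (measurableT_comp measurable_fst).
  apply: measurable_cons => //.
  by apply: (measurableT_comp measurable_snd).
have mB : measurable (c2 @^-1` A) by rewrite -[X in measurable X]setTI; exact: mc2.
have gE q : (gauss_row n \o xsection (c2 @^-1` A)) q =
    gauss_row n [set x : n.-tuple K | A [tuple of q.1 :: [tuple of q.2 :: x]]].
  by congr (gauss_row n _); apply/seteqP; split => x; rewrite /xsection/= inE.
have mg := measurable_fun_xsection (gauss_row n) mB.
have g0 q : (0 <= (gauss_row n \o xsection (c2 @^-1` A)) q)%E by exact: measure_ge0.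
exists (gauss_row n \o xsection (c2 @^-1` A)); split; [exact: mg|exact: gE|].
rewrite (fubini_tonelli1 _ mg g0) /gauss_row tprodS; apply: eq_integral => z _.
rewrite tprodS; apply: eq_integral => w _.
by rewrite gE.
Qed.

Lemma gauss_invariant_givens n a c : c != 0 -> normc2 a + normc2 c = 1 ->
  gauss_invariant (givens_mx n a c).
Proof.
move=> c0 ac1 A mA.
have [g [mg gE ->]] := gauss_rowSS mA.
have [h [mh hE ->]] := gauss_rowSS (measurable_rotate_preimage (givens_mx n a c) mA).
rewrite -(ge0_integral_givens c0 ac1 mg); last by move=> q; rewrite gE.
apply: eq_integral => q _; rewrite hE gE; congr (gauss_row n _).
by apply/seteqP; split => x; rewrite /preimage/= rotate_givens.
Qed.

Definition sqnorm n (x : n.-tuple K) : R := \sum_(i < n) normc2 (cplx (tnth x i)).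

Lemma sqnorm_cons n z (x : n.-tuple K) :
  sqnorm [tuple of z :: x] = normc2 (cplx z) + sqnorm x.
Proof.
by rewrite /sqnorm big_ord_recl; congr (_ + _); apply: eq_bigr => i _; rewrite tnthS.
Qed.

Lemma sqnorm_ge0 n (x : n.-tuple K) : 0 <= sqnorm x.
Proof. by apply: sumr_ge0 => i _; exact: normc2_ge0. Qed.

Lemma normc2_real (x : R) : normc2 (x%:C%C) = x ^+ 2.
Proof. by rewrite /normc2/= expr0n addr0. Qed.

Lemma normc2_conj (z : R[i]) : normc2 ((z^*)%C) = normc2 z.
Proof. by case: z => a b; rewrite /normc2/= sqrrN. Qed.

(** By induction the tail is rotated onto its own first axis; one Givens rotation of the first two
    coordinates then clears the second. *)
Lemma rotate_to_first_axis n (x : n.+1.-tuple K) :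
  exists U : 'M[R[i]]_n.+1, exists rho : R[i],
  [/\ gauss_invariant U, normc2 (\det U) = 1,
      rotate U x = [tuple of pl rho :: tuple_of_row 0] & normc2 rho = sqnorm x].
Proof.
elim: n x => [|n IHn] x.
  exists 1%:M, (cplx (thead x)); split.
  - exact: gauss_invariant1.
  - by rewrite det1 /normc2/= expr1n expr0n addr0.
  - by rewrite rotate1 cplxK [LHS]tuple_eta; apply: eq_from_tnth => j; rewrite ord1.
  - by rewrite {2}(tuple_eta x) sqnorm_cons /sqnorm big_ord0 addr0.
have [U [rho [gU dU rU rhoE]]] := IHn [tuple of behead x].
have rB : rotate (block1 U) x = [tuple of thead x :: [tuple of pl rho :: tuple_of_row 0]].
  by rewrite [in LHS](tuple_eta x) rotate_block1 rU.
have sE : sqnorm x = normc2 (cplx (thead x)) + normc2 rho.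
  by rewrite rhoE {1}(tuple_eta x) sqnorm_cons.
(* If [rho = 0] the row is already on the axis. This case is separate because the shears of a Givens
   rotation divide by the conjugate of [c], which is [rho / N] below. *)
have [rho0|rho0] := eqVneq rho 0.
  exists (block1 U), (cplx (thead x)); split.
  - exact: gauss_invariant_block1.
  - by rewrite det_block1.
  - rewrite rB cplxK rho0; apply: (can_inj (@row_of_tupleK _)); rewrite !row_of_tuple_cons !tuple_of_rowK.
    by rewrite plane_of_complexK raddf0 row_mx0.
  - by rewrite sE rho0 (_ : normc2 0 = 0) ?addr0//; apply/eqP; rewrite normc2_eq0.
pose s := sqnorm x; pose N := (Num.sqrt s)%:C%C.
have s0 : 0 < s.
  rewrite /s sE ltr_wpDl ?normc2_ge0//.
  by rewrite lt_neqAle eq_sym normc2_eq0 rho0 normc2_ge0.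
have N2 : N * N = s%:C%C by rewrite -rmorphM/= -expr2 sqr_sqrtr// ltW.
have N0 : N != 0 by rewrite -normc2_eq0 normc2_real sqrf_eq0 gt_eqF// sqrtr_gt0.
have Nn : normc2 N = s by rewrite normc2_real sqr_sqrtr// ltW.
have NC : (N^*)%C = N by rewrite conjc_real.
(* From here on only the listed properties of the norm [N] are used, and the square root is out of
   the way. *)
clearbody N.
pose z := cplx (thead x); have zE : cplx (thead x) = z by [].
rewrite zE in sE; clearbody z.
(* Conjugates of the unit vector (z, rho) / N: the first new coordinate is (|z|^2 + |rho|^2) / N = N
   and the second is (z rho - rho z) / N = 0. *)
pose a := (z^*)%C / N; pose c := (rho^*)%C / N.
have c0 : c != 0 by rewrite mulf_neq0 ?invr_eq0 ?conjc_eq0.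
have Vn : normc2 N^-1 = s^-1.
  have s0' : s != 0 by rewrite gt_eqF.
  apply: (mulfI s0'); rewrite divff// -{1}Nn -normc2M divff//.
  by rewrite /normc2/= expr1n expr0n addr0.
have ac1 : normc2 a + normc2 c = 1.
  by rewrite !normc2M !normc2_conj Vn -mulrDl -sE divff// gt_eqF.
exists (block1 U *m givens_mx n a c), N; split.
- by apply: gauss_invariantM;
    [exact: gauss_invariant_block1|exact: gauss_invariant_givens].
- by rewrite det_mulmx det_givens_mx mulr1 det_block1.
- have G1 : (givens a c (thead x, pl rho)).1 = pl N.
    rewrite /givens/pairc/= plane_of_complexK zE; congr pl.
    rewrite /a /c ![_ / N * _]mulrAC -mulrDl ![(_^*)%C * _]mulrC.
    by rewrite !mulCC_normc2 -rmorphD/= -sE -/s -N2 mulfK.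
  have G2 : (givens a c (thead x, pl rho)).2 = pl 0.
    rewrite /givens/pairc/= plane_of_complexK zE; congr pl.
    by rewrite /a /c !rmorphM/= !fmorphV/= NC !conjcK; ring.
  rewrite rotateM rB; etransitivity.
    exact: (@rotate_givens n a c (thead x, pl rho) (tuple_of_row 0)).
  rewrite G1 G2; apply: (can_inj (@row_of_tupleK _)); rewrite !row_of_tuple_cons !tuple_of_rowK.
  by rewrite plane_of_complexK raddf0 row_mx0.
- exact: Nn.
Qed.

End rotation.

(** * Determinants of Gaussian matrices *)

Lemma tnth_cons_lshift T n (z : T) (x : n.-tuple T) (i : 'I_1) :
  tnth [tuple of z :: x] (@lshift 1 n i) = z.
Proof. by rewrite (tnth_nth z) ord1. Qed.

Lemma tnth_cons_rshift T n (z : T) (x : n.-tuple T) (i : 'I_n) :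
  tnth [tuple of z :: x] (@rshift 1 n i) = tnth x i.
Proof. by rewrite !(tnth_nth z). Qed.

Section det_recursion.
Context (R : realType).
Local Notation K := (measurableTypeR R * measurableTypeR R)%type.
Local Notation pl := (@plane_of_complex R).

Definition mx_of_tuple k m (X : k.-tuple (m.-tuple K)) : 'M[R[i]]_(k, m) :=
  \matrix_(i, j) cplx (tnth (tnth X i) j).

Lemma mx_of_tuple_map_rotate k m (U : 'M[R[i]]_m) (X : k.-tuple (m.-tuple K)) :
  mx_of_tuple (map_tuple (rotate U) X) = mx_of_tuple X *m U.
Proof.
apply/row_matrixP => i; rewrite row_mul.
rewrite (_ : row i (mx_of_tuple X) = row_of_tuple (tnth X i)); last by apply/rowP => j; rewrite !mxE.
rewrite -row_of_rotate; apply/rowP => j.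
by rewrite !mxE tnth_map.
Qed.

Lemma cmeasurable_mx_of_tuple k m i j :
  cmeasurable (fun X : k.-tuple (m.-tuple K) => mx_of_tuple X i j).
Proof.
under [X in cmeasurable X]eq_fun do rewrite mxE.
apply: cmeasurable_cplx.
apply: (@measurableT_comp _ _ _ _ _ _ (fun x : m.-tuple K => tnth x j)).
  exact: measurable_tnth.
exact: measurable_tnth.
Qed.

(** Rectangular, since removing the first row of a square matrix of size n + 1 leaves n rows of
    length n + 1. *)
Definition gauss_mx k m : probability (k.-tuple (m.-tuple K)) R := tprod (gauss_row R m) k.

(* [normc2] is the squared modulus, so [delta] bounds the squared determinant. *)
Definition small_det n (delta : R) : set (n.-tuple (n.-tuple K)) :=
  [set X | normc2 (\det (mx_of_tuple X)) < delta].

Lemma measurable_small_det n delta : measurable (@small_det n delta).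
Proof.
have mdet : measurable_fun setT (fun X : n.-tuple (n.-tuple K) => normc2 (\det (mx_of_tuple X))).
  apply: measurable_normc2; apply: cmeasurable_det => i j.
  exact: cmeasurable_mx_of_tuple.
rewrite (_ : small_det _ = (fun X => normc2 (\det (mx_of_tuple X))) @^-1` `]-oo, delta[%classic).
  by rewrite -[X in measurable X]setTI; exact: mdet.
by apply/seteqP; split => X /=; rewrite in_itv.
Qed.

Definition behead_row n (x : n.+1.-tuple K) : n.-tuple K := [tuple of behead x].

Lemma gauss_row_behead n (A : set (n.-tuple K)) : measurable A ->
  gauss_row R n.+1 (@behead_row n @^-1` A) = gauss_row R n A.
Proof.
move=> mA; rewrite {1}/gauss_row tprodS.
under eq_integral => z _.
  rewrite (_ : [set x | _] = A); first over.
  apply/seteqP; split=> x /=; rewrite /preimage/behead_row/=;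
    by congr (A _); exact: val_inj.
by rewrite integral_cst// [X in (_ * X)%E]probability_setT mule1.
Qed.

(** With its first row on the axis the matrix is block lower triangular; the column [C] below [rho]
    does not affect the determinant. *)
Lemma det_mx_of_tuple_axis n (rho : R[i]) (Y : n.-tuple (n.+1.-tuple K)) :
  \det (mx_of_tuple [tuple of [tuple of pl rho :: tuple_of_row 0] :: Y]) =
  rho * \det (mx_of_tuple (map_tuple (@behead_row n) Y)).
Proof.
pose C := \col_(i < n) cplx (thead (tnth Y i)).
have E : mx_of_tuple [tuple of [tuple of pl rho :: tuple_of_row 0] :: Y] =
    block_mx (rho%:M : 'M[R[i]]_1) 0 C (mx_of_tuple (map_tuple (@behead_row n) Y))
    :> 'M[R[i]]_(1 + n).
  apply/matrixP => i j; rewrite mxE.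
  case: (split_ordP i) => i' ->; case: (split_ordP j) => j' ->.
  - rewrite block_mxEul !tnth_cons_lshift plane_of_complexK.
    by rewrite !ord1 mxE eqxx mulr1n.
  - rewrite block_mxEur tnth_cons_lshift tnth_cons_rshift tnth_mktuple !mxE.
    by rewrite plane_of_complexK.
  - rewrite block_mxEdl tnth_cons_rshift mxE; congr cplx.
    by rewrite ord1 [in LHS](tuple_eta (tnth Y i')) tnth_cons_lshift.
  - rewrite block_mxEdr tnth_cons_rshift mxE tnth_map; congr cplx.
    by rewrite [in LHS](tuple_eta (tnth Y i')) tnth_cons_rshift.
etransitivity; first exact: (f_equal (@determinant _ n.+1) E).
by etransitivity; [exact: (@det_lblock _ 1 n)|rewrite det_scalar1].
Qed.

Lemma small_det_section n (delta : R) (r : n.+1.-tuple K) : sqnorm r != 0 ->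
  gauss_mx n n.+1 [set X : n.-tuple (n.+1.-tuple K) | small_det delta [tuple of r :: X]] =
  gauss_mx n n (small_det (delta / sqnorm r)).
Proof.
move=> r0; have rp : 0 < sqnorm r by rewrite lt_neqAle eq_sym r0 sqnorm_ge0.
have [U [rho [gU dU rU rhoE]]] := rotate_to_first_axis r.
pose B := [set Y : n.-tuple (n.+1.-tuple K) |
  small_det delta [tuple of [tuple of pl rho :: tuple_of_row 0] :: Y]].
have mbh : measurable_fun setT (@behead_row n) by exact: measurable_behead.
have BE : B = map_tuple (@behead_row n) @^-1` small_det (delta / sqnorm r).
  apply/seteqP; split=> Y; rewrite /B /small_det /preimage/=;
    by rewrite det_mx_of_tuple_axis normc2M rhoE ltr_pdivlMr// mulrC.
(* Read backwards: the smaller Gaussian matrix is obtained from rows of length [n.+1] by deleting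
   their first entries. *)
rewrite -(tprod_map mbh (@gauss_row_behead n) (@measurable_small_det n (delta / sqnorm r))) -BE.
have mB : measurable B.
  rewrite BE -[X in measurable X]setTI.
  exact: (measurable_map_tuple mbh measurableT (@measurable_small_det n _)).
(* [r], hence [U], is fixed here, so rotating the remaining rows by [U] preserves their law; the
   determinant is then multiplied by [\det U], of modulus 1. *)
rewrite -(tprod_map (measurable_rotate U) gU mB).
congr (tprod _ n _); apply/seteqP; split=> X; rewrite /B /small_det /preimage/=;
  rewrite -rU (_ : [tuple of rotate U r :: _] = map_tuple (rotate U) [tuple of r :: X]);
  by [rewrite mx_of_tuple_map_rotate det_mulmx normc2M dU mulr1|exact: val_inj].
Qed.

End det_recursion.

(** * From independent entries to the product law *)

Section matrix_law.
Context (R : realType).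
Local Notation K := (measurableTypeR R * measurableTypeR R)%type.
Local Notation pl := (@plane_of_complex R).

Definition tuple_of_mx n (M : 'M[R[i]]_n) : n.-tuple (n.-tuple K) :=
  [tuple [tuple pl (M i j) | j < n] | i < n].

Lemma tuple_of_mxK n : cancel (@tuple_of_mx n) (@mx_of_tuple R n n).
Proof.
by move=> M; apply/matrixP => i j; rewrite mxE !tnth_mktuple plane_of_complexK.
Qed.

Lemma gaussian_matrix_law d (T : measurableType d) (P : probability T R) n
    (X : T -> 'M[R[i]]_n) (A : set (n.-tuple (n.-tuple K))) :
  gaussian_matrix P X -> measurable A ->
  P [set t | A (tuple_of_mx (X t))] = gauss_mx R n n A.
Proof.
move=> [mX lawX indX] mA.
have mtX : measurable_fun setT (fun t => tuple_of_mx (X t)).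
  apply/measurable_fun_tnthP => i; apply/measurable_fun_tnthP => j.
  rewrite (_ : _ \o _ = fun t => pl (X t i j)); first exact: (mX (i, j)).
  by apply/funext => t /=; rewrite !tnth_mktuple.
have measurableE : @measurable _ K = <<s measurable >>.
  by rewrite sigma_algebra_id//; exact: sigma_algebra_measurable.
change (law P mtX A = gauss_mx R n n A).
(* Boxes whose sides are boxes: such events are conjunctions of conditions on single entries, to
   which independence applies. *)
apply: (@tuple_measure_unique _ (n.-tuple K) R n (rectangle n measurable)) => //.
- by exists (fun=> setT) => //; apply/seteqP; split.
- by apply: rectangle_setI; exact: measurableI.
- exact: measurable_rectangle.
move=> B rB.
have /choice[S SP] i : exists S : 'I_n -> set K, (forall j, measurable (S j)) /\
    B i = [set x | forall j, S j (tnth x j)].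
  by have [S mS BE] := rB i; exists S.
have mB i : measurable (B i).
  by have [mS ->] := SP i; exact: measurable_box.
rewrite tprod_box//.
transitivity (P (\bigcap_(ij in [set ij | ij \in [set: 'I_n * 'I_n]%SET])
   ((fun t => pl (X t ij.1 ij.2)) @^-1` S ij.1 ij.2))).
  rewrite lawE; congr (P _); apply/seteqP; split=> t /=.
    move=> tB [i j] _ /=; have := tB i; have [_ ->] := SP i => /(_ j).
    by rewrite !tnth_mktuple.
  move=> tS i; have [_ ->] := SP i => j; rewrite !tnth_mktuple.
  by apply: (tS (i, j)); rewrite /= inE.
rewrite (indX [set: 'I_n * 'I_n]%SET (fun ij => S ij.1 ij.2)); last first.
  by move=> ij; have [mS _] := SP ij.1; exact: mS.
transitivity (\prod_i \prod_j cgauss R (S i j))%E; last first.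
  apply: eq_bigr => i _; have [mS ->] := SP i.
  by rewrite [RHS]tprod_box.
rewrite pair_big/=; apply: eq_big => [ij|ij _]; first by rewrite inE.
by rewrite lawX//; have [mS _] := SP ij.1; exact: mS.
Qed.

End matrix_law.

(** * Negative moments of the norm of a Gaussian row *)

Section half_line_integrals.
Context (R : realType).
Local Notation mu := (@lebesgue_measure R).

Lemma integral_exp_decay (x : R) : 0 < x ->
  (\int[mu]_(t in `[0%R, +oo[) (expR (- (t * x)))%:E = (x^-1)%:E)%E.
Proof.
move=> x0; have xn0 : x != 0 by rewrite gt_eqF.
have mx : measurable_fun [set: R] (fun t => expR (- (t * x))).
  by apply: measurableT_comp => //; apply: measurableT_comp => //;
    exact: measurable_funM.
(* Normalisation of the exponential density of rate [x]. *)
have H : (\int[mu]_(t in `[0%R, +oo[) (x%:E * (expR (- (t * x)))%:E) = 1)%E.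
  rewrite -(integral_exponential_pdf x0) integral_mkcond.
  apply: eq_integral => t _; rewrite /exponential_pdf !patchE; case: ifP => // _.
  by rewrite -EFinM mulNr (mulrC t).
rewrite ge0_integralZl//= in H; last first.
- by rewrite lee_fin ltW.
- by apply: measurable_funTS; exact/measurable_EFinP.
set I := (\int[_]_(_ in _) _)%E in H *.
have E : (1 = (x^-1)%:E * x%:E)%E by rewrite -EFinM mulVf.
by rewrite -[LHS]mul1e E -muleA H mule1.
Qed.

Lemma integral_power_decay (b : R) (m : nat) : 0 < b ->
  (\int[mu]_(t in `[0%R, +oo[) ((b + t)^-1 ^+ m.+2)%:E =
   (m.+1%:R^-1 * b^-1 ^+ m.+1)%:E)%E.
Proof.
move=> b0.
pose g (t : R) := (b + t)^-1.
have dg (t : R) : 0 <= t -> is_derive t 1 g (- (b + t) ^- 2).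
  move=> t0; have bt : b + t != 0 by rewrite gt_eqF// ltr_wpDr.
  have -> : - (b + t) ^- 2 = - (b + t) ^- 2 *: (1 : R) by rewrite [RHS]mulr1.
  apply: (@is_deriveV R (fun t => b + t)) => //.
  rewrite (_ : (fun t : R => b + t) = shift b); first exact: is_derive_shift.
  by apply/funext => u; rewrite /= addrC.
(* Antiderivative of the integrand; it vanishes at infinity, so the integral is [- F 0]. *)
pose F : R -> R := (- m.+1%:R^-1) \*: (g ^+ m.+1).
have dF (t : R) : 0 <= t -> is_derive t 1 F ((b + t)^-1 ^+ m.+2).
  move=> t0; have bt : b + t != 0 by rewrite gt_eqF// ltr_wpDr.
  have ? := dg t t0; apply: is_derive_eq.
  rewrite /GRing.scale/= /g -exprVn [RHS]exprS [in RHS]exprS.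
  by field; rewrite bt nat1r pnatr_eq0.
have cg (t : R) : 0 <= t -> {for t, continuous g}.
  move=> t0; apply: differentiable_continuous; apply/derivable1_diffP.
  by have [] := dg t t0.
have cF (t : R) : 0 <= t -> {for t, continuous F}.
  move=> t0; apply: differentiable_continuous; apply/derivable1_diffP.
  by have [] := dF t t0.
have FE t : F t = - m.+1%:R^-1 * g t ^+ m.+1 by rewrite /F/= exprfctE.
have cgX (t : R) k : 0 <= t -> g x ^+ k @[x --> t] --> g t ^+ k.
  move=> t0; apply: (@cvg_comp _ _ _ g (fun x => x ^+ k) _ _ _ (cg t t0)).
  exact: exprn_continuous.
have goo : g t @[t --> +oo] --> 0.
  apply/gtr0_cvgV0; last exact: cvg_addrl.
  by near=> t; rewrite ltr_wpDr//; near: t; exact: nbhs_pinfty_ge.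
rewrite (@ge0_continuous_FTC2y R (fun t => (b + t)^-1 ^+ m.+2) F 0 0).
- by rewrite FE /g addr0 -EFinB mulNr sub0r opprK.
- by move=> t t0; rewrite exprn_ge0// invr_ge0 addr_ge0// ltW.
- apply/continuous_within_itvcyP; split.
    by move=> t; rewrite in_itv/= andbT => t0; apply: cgX; exact: ltW.
  by apply: cvg_at_right_filter; exact: cgX.
- rewrite (_ : F = (fun t => - m.+1%:R^-1 * g t ^+ m.+1)); last exact/funext.
  rewrite -[X in _ --> X](mulr0 (- m.+1%:R^-1)); apply: cvgMr.
  have := @cvg_comp _ _ _ g (fun x => x ^+ m.+1) _ _ _ goo.
  by move/(_ _ (@exprn_continuous _ m.+1 0)); rewrite expr0n.
- by move=> t t0; have [] := dF t (ltW t0).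
- by apply: cvg_at_right_filter; exact: cF.
- move=> t; rewrite in_itv/= andbT => t0; rewrite derive1E.
  by have [_ ->] := dF t (ltW t0).
Unshelve. all: by end_near.
Qed.

End half_line_integrals.

Section moments.
Context (R : realType).
Local Notation mu := (@lebesgue_measure R).
Local Notation K := (measurableTypeR R * measurableTypeR R)%type.

Lemma measurable_sqnorm n : measurable_fun setT (@sqnorm R n).
Proof.
apply: (@measurable_sum _ _ R setT) => i.
apply: measurable_normc2; apply: cmeasurable_cplx; exact: measurable_tnth.
Qed.

Lemma measurable_laplace n (c : R) :
  measurable_fun setT (fun r : n.-tuple K => expR (- (c * sqnorm r))).
Proof.
apply: measurableT_comp => //; apply: measurableT_comp => //.
by apply: measurable_funM => //; exact: measurable_sqnorm.
Qed.

Lemma laplace_sqnorm n (c : R) : 0 <= c ->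
  (\int[gauss_row R n]_r (expR (- (c * sqnorm r)))%:E = ((1 + c)^-1 ^+ n)%:E)%E.
Proof.
move=> c0; elim: n => [|n IHn].
  under eq_integral do rewrite /sqnorm big_ord0 mulr0 oppr0 expR0.
  by rewrite integral_cst// mul1e [LHS]probability_setT expr0.
have mn := @measurable_laplace n c.
have mEn : measurable_fun setT (fun r : n.+1.-tuple K => (expR (- (c * sqnorm r)))%:E).
  by apply/measurable_EFinP; exact: measurable_laplace.
rewrite /gauss_row (ge0_integral_tprodS _ mEn)//.
rewrite -/(gauss_row R n).
transitivity (\int[cgauss R]_z
   ((expR (- (c * normc2 (cplx z))))%:E * ((1 + c)^-1 ^+ n)%:E))%E.
  apply: eq_integral => z _; rewrite -IHn -ge0_integralZl//.
  - by apply: eq_integral => x _; rewrite sqnorm_cons -EFinM -expRD -opprD mulrDr.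
  - exact/measurable_EFinP.
have mz : measurable_fun [set: K] (fun z : K => expR (- (c * normc2 (cplx z)))).
  apply: measurableT_comp => //; apply: measurableT_comp => //.
  apply: measurable_funM => //; apply: measurable_normc2.
  exact: cmeasurable_cplx.
rewrite ge0_integralZr//; last 2 first.
- exact/measurable_EFinP.
- by rewrite lee_fin exprn_ge0// invr_ge0; lra.
by rewrite laplace_cgauss// -EFinM exprS.
Qed.

(** For every c >= 0 the indicator of the event is at most exp(-c ||r||^2), whose expectation tends
    to 0 as c grows. *)
Lemma gauss_row_sqnorm_eq0 n : gauss_row R n.+1 [set r | sqnorm r = 0] = 0%E.
Proof.
set Z := [set r | _].
have mZ : measurable Z.
  rewrite (_ : Z = @sqnorm R n.+1 @^-1` [set 0])//.
  rewrite -[X in measurable X]setTI; exact: measurable_sqnorm.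
have ub c : 0 <= c -> (gauss_row R n.+1 Z <= ((1 + c)^-1)%:E)%E.
  move=> c0; apply: (@le_trans _ _ ((1 + c)^-1 ^+ n.+1)%:E); last first.
    by rewrite lee_fin exprS ler_piMr ?exprn_ile1 ?invr_ge0 ?invf_le1; lra.
  rewrite -laplace_sqnorm// -(setIT Z) -integral_indic//.
  apply: ge0_le_integral => //.
  - exact/measurable_EFinP/measurable_indic.
  - by apply/measurable_EFinP; exact: measurable_laplace.
  - move=> r _; rewrite lee_fin indicE.
    case: (boolP (r \in Z)) => [|_]; last exact: expR_ge0.
    by rewrite inE /Z/= => ->; rewrite mulr0 oppr0 expR0.
apply/eqP; rewrite eq_le measure_ge0 andbT.
have pf := fin_num_measure (gauss_row R n.+1) _ mZ.
have /fineK/esym := pf; move: (fine _) => p pE.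
rewrite pE lee_fin leNgt; apply/negP => p0.
(* If the mass [p] were positive, c = 1/p would give p <= p / (1 + p), a contradiction. *)
have := ub p^-1; rewrite pE lee_fin invr_ge0 ltW// => /(_ isT).
have -> : (1 + p^-1)^-1 = p / (1 + p) by field; rewrite !gt_eqF//; lra.
rewrite ler_pdivlMr; last lra.
by rewrite mulrDr mulr1 gerDl leNgt mulr_gt0.
Qed.

(* The factor [sqnorm r != 0] makes [inv_weightS] hold also at [r = 0], where
   [0^-1 = 0]. *)
Definition inv_weight n k (c : R) (r : n.-tuple K) : R :=
  (sqnorm r != 0)%:R * (sqnorm r)^-1 ^+ k * expR (- (c * sqnorm r)).

Lemma inv_weight_ge0 n k c (r : n.-tuple K) : 0 <= inv_weight k c r.
Proof.
by rewrite !mulr_ge0 ?expR_ge0// exprn_ge0// invr_ge0 sqnorm_ge0.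
Qed.

(** [c] and [r] vary together because Tonelli in [inv_momentE] needs joint measurability in the row
    and the tilt. *)
Lemma measurable_inv_weight n k (d : measure_display) (T : measurableType d)
    (c : T -> R) (r : T -> n.-tuple K) :
  measurable_fun setT c -> measurable_fun setT r ->
  measurable_fun setT (fun x => inv_weight k (c x) (r x)).
Proof.
move=> mc mr; have mS : measurable_fun setT (fun x => sqnorm (r x)).
  exact: measurableT_comp (@measurable_sqnorm n) mr.
apply: measurable_funM; last first.
  apply: measurableT_comp => //; apply: measurableT_comp => //.
  exact: measurable_funM.
apply: measurable_funM.
  rewrite (_ : (fun _ => _) = \1_(~` [set 0 : R]) \o (fun x => sqnorm (r x))).
    by apply: measurableT_comp => //; apply: measurable_indic; exact: measurableC.
  apply/funext => x /=; rewrite indicE; congr (_%:R); congr nat_of_bool.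
  by apply/idP/idP => [?|]; [rewrite inE/=; exact/eqP|rewrite inE/= => /eqP].
apply: measurable_funX.
rewrite (_ : (fun _ => _) = (@powR R ^~ (- 1)) \o (fun x => sqnorm (r x))).
  exact: measurableT_comp (@measurable_powR R (- 1)) mS.
by apply/funext => x /=; rewrite powR_inv1// sqnorm_ge0.
Qed.

End moments.

Section inverse_moments.
Context (R : realType).
Local Notation mu := (@lebesgue_measure R).
Local Notation K := (measurableTypeR R * measurableTypeR R)%type.

Definition inv_moment n k c : \bar R := (\int[gauss_row R n]_r (inv_weight k c r)%:E)%E.

Lemma measurable_inv_weight_row n k c :
  measurable_fun setT (fun r : n.-tuple K => (inv_weight k c r)%:E).
Proof.
apply/measurable_EFinP.
exact: (@measurable_inv_weight R n k _ _ (fun=> c) id).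
Qed.

Lemma inv_moment0 n c : 0 <= c -> inv_moment n.+1 0 c = ((1 + c)^-1 ^+ n.+1)%:E.
Proof.
move=> c0; rewrite -laplace_sqnorm// /inv_moment.
pose Z : set (n.+1.-tuple K) := [set r | sqnorm r = 0].
have mZ : measurable Z.
  rewrite (_ : Z = @sqnorm R n.+1 @^-1` [set 0])//.
  rewrite -[X in measurable X]setTI; exact: measurable_sqnorm.
(* [inv_weight] vanishes at r = 0, where the exponential is 1; the indicator of this null event
   makes up the difference. *)
transitivity (\int[gauss_row R n.+1]_r ((inv_weight 0 c r)%:E + (\1_Z r)%:E))%E.
  rewrite ge0_integralD//.
  - by rewrite integral_indic// setIT [X in (_ + X)%E]gauss_row_sqnorm_eq0 adde0.
  - by move=> r _; rewrite lee_fin inv_weight_ge0.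
  - exact: measurable_inv_weight_row.
  - by apply/measurable_EFinP; exact: measurable_indic.
apply: eq_integral => r _; rewrite -EFinD; congr EFin.
rewrite /inv_weight expr0 mulr1 indicE.
have [S0|S0] := eqVneq (sqnorm r) 0.
  by rewrite mul0r add0r mem_set//= S0 mulr0 oppr0 expR0.
by rewrite mul1r memNset/= ?addr0//; exact/eqP.
Qed.

Lemma inv_weightS n k c (r : n.-tuple K) :
  (\int[mu]_(t in `[0%R, +oo[) (inv_weight k (c + t) r)%:E =
   (inv_weight k.+1 c r)%:E)%E.
Proof.
rewrite /inv_weight; have [S0|S0] := eqVneq (sqnorm r) 0.
  by rewrite !mul0r integral0_eq// => t _; rewrite !mul0r.
have Sp : 0 < sqnorm r by rewrite lt_neqAle eq_sym S0 sqnorm_ge0.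
pose b := (sqnorm r)^-1 ^+ k * expR (- (c * sqnorm r)).
have b0 : 0 <= b by rewrite mulr_ge0 ?expR_ge0// exprn_ge0// invr_ge0 ltW.
transitivity (\int[mu]_(t in `[0%R, +oo[) (b%:E * (expR (- (t * sqnorm r)))%:E))%E.
  apply: eq_integral => t _; rewrite -EFinM; congr EFin.
  by rewrite mul1r mulrDl opprD expRD /b mulrA.
rewrite ge0_integralZl//=; last first.
- apply: measurable_funTS; apply/measurable_EFinP.
  by apply: measurableT_comp => //; apply: measurableT_comp => //; exact: measurable_funM.
rewrite integral_exp_decay// -EFinM; congr EFin.
by rewrite /b mul1r exprSr; ring.
Qed.

(** The tilt [c] drives the induction: integrating it from [c] to infinity raises [k] by one, by
    [inv_weightS]. The size [m.+1 + k] expresses k < n, the range in which the moment is finite. *)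
Lemma inv_momentE k m c : 0 <= c ->
  inv_moment (m.+1 + k) k c =
  ((\prod_(i < k) (m.+1 + i)%:R^-1) * (1 + c)^-1 ^+ m.+1)%:E.
Proof.
elim: k m c => [|k IHk] m c c0.
  by rewrite addn0 inv_moment0// big_ord0 mul1r.
(* The same size is read as [m.+2 + k], so the induction hypothesis supplies the exponent [m.+2],
   whose integral contributes the new factor [m.+1%:R^-1]. *)
rewrite addnS -addSn; set n := (m.+2 + k)%N.
pose D : set (measurableTypeR R) := `[0, +oo[%classic.
have mD : measurable D by exact: measurable_itv.
pose f (p : n.-tuple K * measurableTypeR R) : \bar R :=
  ((inv_weight k (c + p.2) p.1)%:E * (\1_D p.2)%:E)%E.
have mf : measurable_fun setT f.
  apply: emeasurable_funM; apply/measurable_EFinP.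
    apply: (@measurable_inv_weight R n k _ _ (fun p => c + p.2) fst) => //.
    exact: measurable_funD.
  by apply: (measurableT_comp (measurable_indic mD)).
have f0 p : (0 <= f p)%E by rewrite mule_ge0 ?lee_fin ?inv_weight_ge0.
transitivity (\int[gauss_row R n]_r \int[mu]_t f (r, t))%E.
  apply: eq_integral => r _; rewrite -inv_weightS integral_mkcond.
  by rewrite epatch_indic.
rewrite (fubini_tonelli f mf f0).
transitivity (\int[mu]_(t in D) inv_moment n k (c + t))%E.
  rewrite [RHS]integral_mkcond epatch_indic; apply: eq_integral => t _ /=.
  rewrite /f/= ge0_integralZr//.
  - exact: measurable_inv_weight_row.
  - by move=> r _; rewrite lee_fin inv_weight_ge0.
have bp : 0 < 1 + c by rewrite ltr_pwDl.
pose M : R := \prod_(i < k) (m.+2 + i)%:R^-1.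
have M0 : 0 <= M by apply: prodr_ge0 => i _; rewrite invr_ge0.
transitivity (\int[mu]_(t in D) (M%:E * (((1 + c) + t)^-1 ^+ m.+2)%:E))%E.
  apply: eq_integral => t; rewrite inE /D/= in_itv/= andbT => t0.
  by rewrite IHk ?addr_ge0// EFinM addrA.
rewrite ge0_integralZl//=; last 2 first.
- apply: (@eq_measurable_fun _ _ _ _ _
    (fun t : measurableTypeR R => (((1 + c + t) `^ (- 1)) ^+ m.+2)%:E)).
    move=> t; rewrite inE /D/= in_itv/= andbT => t0.
    by rewrite powR_inv1// addr_ge0// ltW.
  apply/measurable_EFinP; apply: measurable_funTS; apply: measurable_funX.
  by apply: (measurableT_comp (@measurable_powR R (- 1))); exact: measurable_funD.
- by move=> t; rewrite /D/= in_itv/= andbT => t0; rewrite lee_fin exprn_ge0// invr_ge0 addr_ge0// ltW.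
rewrite integral_power_decay// -EFinM big_ord_recl addn0; congr EFin.
rewrite (_ : \prod_(i < k) _ = M); last first.
  by apply: eq_bigr => i _; rewrite lift0 addnS.
by ring.
Qed.

End inverse_moments.

(** * Polynomial bounds for real powers *)

Section powR_taylor.
Context (R : realType).
Implicit Types a x y p : R.

(** Chains exp u >= 1 + u at u = p ln x with ln x <= x - 1, the latter reversed by p <= 0. *)
Lemma powR_ge_tangent p x : p <= 0 -> 0 < x -> 1 + p * (x - 1) <= x `^ p.
Proof.
move=> p0 x0; rewrite /powR gt_eqF//.
apply: (le_trans _ (expR_ge1Dx _)); rewrite lerD2l ler_wnM2l//.
have := @le_ln1Dx R (x - 1); rewrite (_ : 1 + (x - 1) = x); last by ring.
by apply; lra.
Qed.

(** Weighted AM-GM: once y^a = exp(a L) is factored out, both remaining exponentials are bounded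
    below by their tangents at 0, and the terms linear in L cancel. *)
Lemma powR_le_tangent a y : 0 <= a -> a <= 1 -> 0 <= y -> y `^ a <= 1 + a * (y - 1).
Proof.
move=> a0 a1; rewrite le_eqVlt => /predU1P[<-|y0].
  have [->|an0] := eqVneq a 0; first by rewrite powRr0; lra.
  by rewrite powR0//; lra.
rewrite /powR gt_eqF//; set L := ln y.
have yE : y = expR (a * L) * expR ((1 - a) * L).
  rewrite -expRD -mulrDl (_ : a + (1 - a) = 1) ?mul1r ?lnK ?posrE//.
  by ring.
have uE : 1 = expR (a * L) * expR (- (a * L)) by rewrite -expRD subrr expR0.
rewrite (_ : 1 + a * (y - 1) = expR (a * L) *
   (a * expR ((1 - a) * L) + (1 - a) * expR (- (a * L)))); last first.
  transitivity (a * (expR (a * L) * expR ((1 - a) * L)) +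
    (1 - a) * (expR (a * L) * expR (- (a * L)))); last by ring.
  by rewrite -yE -uE; ring.
rewrite -[leLHS]mulr1 ler_wpM2l ?expR_ge0//.
have e1 := expR_ge1Dx ((1 - a) * L); have e2 := expR_ge1Dx (- (a * L)).
have m1 : a * (1 + (1 - a) * L) <= a * expR ((1 - a) * L) by rewrite ler_wpM2l.
have m2 : (1 - a) * (1 - a * L) <= (1 - a) * expR (- (a * L)).
  by rewrite ler_wpM2l// subr_ge0.
apply: (le_trans _ (lerD m1 m2)); rewrite le_eqVlt; apply/orP; left; apply/eqP.
by ring.
Qed.

(** The sign condition records that [c] is on the same side of 1 as [y]; this covers both orderings
    at once and lets the lemma be iterated. *)
Lemma MVT_at1 (f df : R -> R) y : (forall x, 0 < x -> is_derive x 1 f (df x)) ->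
  f 1 = 0 -> 0 < y -> exists c, [/\ 0 < c, 0 <= (c - 1) * (y - 1) & f y = df c * (y - 1)].
Proof.
move=> dF f1 y0.
have cf x : 0 < x -> {for x, continuous f}.
  move=> x0; apply: differentiable_continuous; apply/derivable1_diffP.
  by have [] := dF x x0.
have cfs u v : 0 < u -> {within `[u, v], continuous f}.
  move=> u0; apply: continuous_in_subspaceT => x; rewrite inE/= in_itv/= => /andP[ux _].
  exact: cf (lt_le_trans u0 ux).
have [y1|y1] := leP y 1.
  have [|c] := @MVT_segment R f df y 1 y1 _ (cfs _ _ y0).
    by move=> x; rewrite in_itv/= => /andP[yx _]; apply: dF; exact: lt_trans yx.
  rewrite in_itv/= => /andP[yc c1]; rewrite f1 sub0r => /(congr1 -%R).
  rewrite opprK -mulrN opprB => fE; exists c; split=> //.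
    exact: lt_le_trans yc.
  by rewrite mulr_le0// subr_le0.
have [|c] := @MVT_segment R f df 1 y (ltW y1) _ (cfs _ _ ltr01).
  by move=> x; rewrite in_itv/= => /andP[yx _]; apply: dF; exact: lt_trans yx.
rewrite in_itv/= => /andP[c1 yc]; rewrite f1 subr0 => fE; exists c; split=> //.
  exact: lt_le_trans c1.
by rewrite mulr_ge0// subr_ge0// ltW.
Qed.

(* Taylor polynomial of odd order at 1: the fourth derivative of the power
   function is negative on the whole half line. *)
Lemma powR_le_cubic a y : 0 <= a -> a <= 1 -> 0 <= y ->
  y `^ a <= 1 + a * (y - 1) - a * (1 - a) / 2 * (y - 1) ^+ 2
            + a * (1 - a) * (2 - a) / 6 * (y - 1) ^+ 3.
Proof.
move=> a0 a1; rewrite le_eqVlt => /predU1P[<-|y0].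
  have [->|an0] := eqVneq a 0; first by rewrite powRr0; lra.
  rewrite powR0// [leRHS](_ : _ = (1 - a) * (2 - a) * (3 - a) / 6); last by field.
  by rewrite !mulr_ge0//; lra.
pose B := a * (1 - a) / 2; pose C := a * (1 - a) * (2 - a) / 6.
pose q : R -> R := id - cst 1.
pose g0 : R -> R := cst 1 + a \*: q - B \*: q ^+ 2 + C \*: q ^+ 3 - (fun x : R => x `^ a).
pose g1 : R -> R := cst a - (2 * B) \*: q + (3 * C) \*: q ^+ 2 - a \*: (fun x : R => x `^ (a - 1)).
pose g2 x : R := - 2 * B + 6 * C * (x - 1) - a * ((a - 1) * x `^ (a - 1 - 1)).
have g0E x : g0 x = 1 + a * (x - 1) - B * (x - 1) ^+ 2 + C * (x - 1) ^+ 3 - x `^ a.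
  by rewrite /g0 /q !fctE.
have g1E x : g1 x = a - 2 * B * (x - 1) + 3 * C * (x - 1) ^+ 2 - a * x `^ (a - 1).
  by rewrite /g1 /q !fctE.
have d0 x : 0 < x -> is_derive x 1 g0 (g1 x).
  move=> x0; have dp := @is_derive1_powR R a x x0.
  apply: is_derive_eq; rewrite g1E /GRing.scale/= /q !fctE/=.
  by ring.
have d1 x : 0 < x -> is_derive x 1 g1 (g2 x).
  move=> x0; have dp := @is_derive1_powR R (a - 1) x x0.
  apply: is_derive_eq; rewrite /g2 /GRing.scale/= /q !fctE/=.
  by ring.
(* The second derivative is a (1 - a) times the gap between x^(a-2) and its tangent at 1. *)
have g2_ge0 x : 0 < x -> 0 <= g2 x.
  move=> x0; have := @powR_ge_tangent (a - 2) x; rewrite (_ : a - 2 = a - 1 - 1); last by ring.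
  move=> /(_ _ x0); set P := _ `^ _ => tg.
  have {}tg : 1 + (a - 1 - 1) * (x - 1) <= P by apply: tg; lra.
  rewrite /g2 -/P (_ : _ - _ = a * (1 - a) * (P - (1 + (a - 1 - 1) * (x - 1)))); last first.
    by rewrite /B /C; field.
  by rewrite !mulr_ge0// subr_ge0.
have g11 : g1 1 = 0 by rewrite g1E subrr powR1 expr0n/=; ring.
have g01 : g0 1 = 0 by rewrite g0E subrr powR1 !expr0n/=; ring.
suff : 0 <= g0 y by rewrite g0E subr_ge0.
(* Two mean value steps give g0 y = g2 e (c - 1) (y - 1), a product of nonnegative factors. *)
have [c [c0 cy ->]] := MVT_at1 d0 g01 y0.
have [e [e0 _ ->]] := MVT_at1 d1 g11 c0.
by rewrite -mulrA mulr_ge0// g2_ge0.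
Qed.

End powR_taylor.

Section negative_moment.
Context (R : realType).
Local Notation K := (measurableTypeR R * measurableTypeR R)%type.
Variable a : R.
Hypotheses (a0 : 0 <= a) (a1 : a <= 1).

(** The same indicator as in [inv_weight] makes the pointwise comparisons trivial at r = 0, where
    [powR] would give 1 for a = 0. *)
Definition neg_weight n (r : n.-tuple K) : R :=
  (sqnorm r != 0)%:R * (sqnorm r)^-1 `^ a.

Definition neg_moment n : \bar R := (\int[gauss_row R n]_r (neg_weight r)%:E)%E.

Lemma neg_weight_ge0 n (r : n.-tuple K) : 0 <= neg_weight r.
Proof. by rewrite mulr_ge0// powR_ge0. Qed.

Lemma inv_weight00 n (r : n.-tuple K) k :
  inv_weight k 0 r = (sqnorm r != 0)%:R * (sqnorm r)^-1 ^+ k.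
Proof. by rewrite /inv_weight mul0r oppr0 expR0 mulr1. Qed.

Lemma measurable_neg_weight n :
  measurable_fun setT (fun r : n.-tuple K => (neg_weight r)%:E).
Proof.
apply/measurable_EFinP.
have mS := @measurable_sqnorm R n.
apply: measurable_funM.
  have /measurable_EFinP := @measurable_inv_weight_row R n 0 0.
  congr (measurable_fun _ _).
  by apply/funext => r; rewrite inv_weight00 expr0 mulr1.
rewrite (_ : (fun _ => _) = (@powR R ^~ (- a)) \o @sqnorm R n).
  exact: measurableT_comp (@measurable_powR R (- a)) mS.
apply/funext => r /=; have S0 := sqnorm_ge0 r.
by rewrite -(powR_inv1 S0) -powRrM mulN1r.
Qed.

Lemma integral_comb2 n (f g : n.-tuple K -> R) (b c : R) :
  measurable_fun setT (fun r => (f r)%:E) -> measurable_fun setT (fun r => (g r)%:E) ->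
  (forall r, 0 <= f r) -> (forall r, 0 <= g r) -> 0 <= b -> 0 <= c ->
  (\int[gauss_row R n]_r (b * f r + c * g r)%:E =
   b%:E * (\int[gauss_row R n]_r (f r)%:E) + c%:E * (\int[gauss_row R n]_r (g r)%:E))%E.
Proof.
move=> mf mg f0 g0 b0 c0.
rewrite -ge0_integralZl//; last by move=> r _; rewrite lee_fin.
rewrite -ge0_integralZl//; last by move=> r _; rewrite lee_fin.
rewrite -ge0_integralD//.
- by move=> r _; rewrite mule_ge0// lee_fin.
- by apply: emeasurable_funM.
- by move=> r _; rewrite mule_ge0// lee_fin.
- by apply: emeasurable_funM.
Qed.

Lemma inv_moment_fin n k (M : R) : inv_moment n k (0 : R) = M%:E ->
  (\int[gauss_row R n]_r (inv_weight k (0 : R) r)%:E = M%:E)%E.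
Proof. by []. Qed.

(** Takes over at sizes 2 and 3, below the range of the cubic bound: the tangent inequality at 1 /
    ||r||^2 needs only the first inverse moment, which is at most 1. *)
Lemma neg_moment_le1 m : (neg_moment m.+2 <= 1)%E.
Proof.
have I0 : inv_moment m.+2 0 (0 : R) = 1%:E.
  by rewrite inv_moment0// addr0 invr1 expr1n.
have I1 : inv_moment m.+2 1 (0 : R) = (m.+1%:R^-1)%:E.
  have := @inv_momentE R 1 m 0 (lexx _).
  by rewrite addn1 big_ord_recl big_ord0 addr0 invr1 expr1n !mulr1 addn0.
have w0 k (r : m.+2.-tuple K) := @inv_weight_ge0 R m.+2 k 0 r.
have mw k := @measurable_inv_weight_row R m.+2 k 0.
apply: (@le_trans _ _ (\int[gauss_row R m.+2]_r
   ((1 - a) * inv_weight 0 0 r + a * inv_weight 1 0 r)%:E)%E).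
  apply: ge0_le_integral => //.
  - by move=> r _; rewrite lee_fin neg_weight_ge0.
  - exact: measurable_neg_weight.
  - apply/measurable_EFinP; apply: measurable_funD.
      by apply: measurable_funM; [exact: measurable_cst|apply/measurable_EFinP; exact: mw].
    by apply: measurable_funM; [exact: measurable_cst|apply/measurable_EFinP; exact: mw].
  - move=> r _; rewrite lee_fin !inv_weight00 /neg_weight expr0 expr1.
    rewrite mulrCA [a * _]mulrCA -mulrDr ler_wpM2l// mulr1.
    apply: (le_trans (powR_le_tangent a0 a1 _)); first by rewrite invr_ge0 sqnorm_ge0.
    by rewrite le_eqVlt; apply/orP; left; apply/eqP; ring.
rewrite integral_comb2// ?subr_ge0//.
rewrite (inv_moment_fin I0) (inv_moment_fin I1) -!EFinM -EFinD lee_fin mulr1.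
have : a * m.+1%:R^-1 <= a by rewrite ler_piMr// invf_le1// ler1n.
by set t := a * _ => ta; rewrite -lerBrDl opprB addrC subrK.
Qed.

(* Integrates [powR_le_cubic] at [y = N / sqnorm r], where [N^-1] is the mean of
   [1 / sqnorm r]; the only negative coefficient of the cubic is that of [y ^+ 2]. *)
Lemma neg_moment_le m (N : R) : N = m.+3%:R ->
  (neg_moment m.+4 <= (N^-1 `^ a * (1 - a * (1 - a) / 2 / (N - 1) +
     a * (1 - a) * (2 - a) / 6 * 4 / ((N - 1) * (N - 2))))%:E)%E.
Proof.
move=> NE; pose n := m.+4; rewrite -/n.
have N3 : 3 <= N by rewrite NE ler_nat.
have N1 : N - 1 = m.+2%:R by rewrite NE -(addn1 m.+2) natrD addrK.
have N2 : N - 2 = m.+1%:R by rewrite NE -(addn2 m.+1) natrD addrK.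
have I0 : inv_moment n 0 (0 : R) = 1%:E.
  by rewrite inv_moment0// addr0 invr1 expr1n.
have I1 : inv_moment n 1 (0 : R) = (N^-1)%:E.
  have := @inv_momentE R 1 m.+2 0 (lexx _).
  by rewrite NE addn1 big_ord_recl big_ord0 addr0 invr1 expr1n !mulr1 addn0.
have I2 : inv_moment n 2 (0 : R) = ((N - 1)^-1 * N^-1)%:E.
  have := @inv_momentE R 2 m.+1 0 (lexx _).
  by rewrite addn2 2!big_ord_recl big_ord0 addr0 invr1 expr1n !mulr1 addn0 lift0 addn1 N1 NE.
have I3 : inv_moment n 3 (0 : R) = ((N - 2)^-1 * ((N - 1)^-1 * N^-1))%:E.
  have := @inv_momentE R 3 m 0 (lexx _).
  rewrite addn3 3!big_ord_recl big_ord0 addr0 invr1 expr1n !mulr1 addn0 !lift0.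
  by rewrite addn1 addn2 N1 N2 NE.
have w0 k (r : n.-tuple K) := @inv_weight_ge0 R n k 0 r.
have mw k := @measurable_inv_weight_row R n k 0.
have mwR k : measurable_fun setT (fun r : n.-tuple K => inv_weight k 0 r).
  by apply/measurable_EFinP; exact: mw.
pose B := a * (1 - a) / 2; pose C := a * (1 - a) * (2 - a) / 6.
have [a0h a1h] : 0 <= a /\ a <= 1 by [].
have B0 : 0 <= B by rewrite /B !mulr_ge0//; lra.
have C0 : 0 <= C by rewrite /C !mulr_ge0//; lra.
pose P := N^-1 `^ a.
have P0 : 0 <= P by exact: powR_ge0.
(* Absolute values of the coefficients of 1, y and y^2 once the cubic is expanded at 0; that of y^3
   is [C]. *)
pose c0 := 1 - a - B - C; pose c1 := a + 2 * B + 3 * C; pose c2 := B + 3 * C.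
have c00 : 0 <= c0.
  rewrite (_ : c0 = (1 - a) * (2 - a) * (3 - a) / 6); last by rewrite /c0 /B /C; field.
  by rewrite !mulr_ge0//; lra.
have c10 : 0 <= c1 by rewrite /c1; lra.
have c20 : 0 <= c2 by rewrite /c2; lra.
have Npos : 0 < N by lra.
(* The y^2 term is moved to the left so that only nonnegative functions are integrated; it is
   subtracted afterwards, between finite numbers. *)
have key (r : n.-tuple K) :
  1 * neg_weight r + (P * c2 * N ^+ 2) * inv_weight 2 0 r <=
  1 * ((P * c0) * inv_weight 0 0 r + (P * c1 * N) * inv_weight 1 0 r) +
  (P * C * N ^+ 3) * inv_weight 3 0 r.
  rewrite !inv_weight00 /neg_weight; set u := (sqnorm r)^-1; set i := (_ != 0)%:R.
  have u0 : 0 <= u by rewrite invr_ge0 sqnorm_ge0.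
  have uP : u `^ a = P * (N * u) `^ a.
    rewrite /P -powRM ?invr_ge0 ?mulr_ge0//; try lra.
    by rewrite mulKf// gt_eqF.
  have Nu : 0 <= N * u by rewrite mulr_ge0// ltW.
  have H := powR_le_cubic a0 a1 Nu.
  have {}H : P * i * (N * u) `^ a <= P * i * (1 + a * (N * u - 1) - B * (N * u - 1) ^+ 2
      + C * (N * u - 1) ^+ 3) by rewrite ler_wpM2l// mulr_ge0// /i ler0n.
  rewrite uP -subr_ge0; move: H; rewrite -subr_ge0; congr (is_true (0 <= _)).
  by rewrite /c0 /c1 /c2; ring.
have := @ge0_le_integral _ _ R (gauss_row R n) setT measurableT
  (fun r => (1 * neg_weight r + (P * c2 * N ^+ 2) * inv_weight 2 0 r)%:E)
  (fun r => (1 * ((P * c0) * inv_weight 0 0 r + (P * c1 * N) * inv_weight 1 0 r) +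
     (P * C * N ^+ 3) * inv_weight 3 0 r)%:E).
have mneg := @measurable_neg_weight n.
have n0 (r : n.-tuple K) := neg_weight_ge0 r.
have PN k c : 0 <= c -> 0 <= P * c * N ^+ k.
  by move=> ?; rewrite !mulr_ge0// exprn_ge0// ltW.
have PN1 : 0 <= P * c1 * N by rewrite !mulr_ge0// ltW.
have m01 : measurable_fun setT (fun r : n.-tuple K =>
    ((P * c0) * inv_weight 0 0 r + (P * c1 * N) * inv_weight 1 0 r)%:E).
  by apply/measurable_EFinP; apply: measurable_funD; exact: measurable_funM.
have g01 (r : n.-tuple K) :
    0 <= (P * c0) * inv_weight 0 0 r + (P * c1 * N) * inv_weight 1 0 r.
  by rewrite addr_ge0// mulr_ge0// mulr_ge0.
have [b1 b2 N0] : [/\ 0 <= 1 - a, 0 <= 2 - a & 0 <= N] by split; lra.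
rewrite !integral_comb2// ?mulr_ge0 ?PN//.
rewrite (inv_moment_fin I0) (inv_moment_fin I1) (inv_moment_fin I2) (inv_moment_fin I3).
rewrite !mul1e -/(neg_moment n) -!EFinM -!EFinD => H.
have {}H : (neg_moment n + (P * c2 * N ^+ 2 * ((N - 1)^-1 / N))%:E <=
  (P * c0 * 1 + P * c1 * N / N + P * C * N ^+ 3 * ((N - 2)^-1 * ((N - 1)^-1 / N)))%:E)%E.
  apply: H.
  - by move=> r _; rewrite lee_fin addr_ge0// mulr_ge0// PN.
  - apply/measurable_EFinP; apply: measurable_funD; apply: measurable_funM => //.
    by apply/measurable_EFinP; exact: mneg.
  - apply/measurable_EFinP; apply: measurable_funD; apply: measurable_funM => //.
    by apply/measurable_EFinP; exact: m01.
  - by move=> r _; rewrite lee_fin key.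
rewrite -leeBrDr// -EFinB in H.
apply: (le_trans H); rewrite lee_fin le_eqVlt; apply/orP; left; apply/eqP.
rewrite -/P -/B -/C /c0 /c1 /c2; field.
by rewrite !gt_eqF//; lra.
Qed.

End negative_moment.

(** * Small-ball estimate *)

Section small_ball.
Context (R : realType).
Local Notation K := (measurableTypeR R * measurableTypeR R)%type.

Definition small_det_prob n (delta : R) : \bar R := gauss_mx R n n (small_det delta).

Lemma measurable_small_det_section n delta :
  measurable_fun setT (fun r : n.+1.-tuple K =>
    gauss_mx R n n.+1 [set X : n.-tuple (n.+1.-tuple K) |
      small_det delta [tuple of r :: X]]).
Proof.
have mB : measurable (@cons_pair _ (n.+1.-tuple K) n @^-1` small_det delta).
  rewrite -[X in measurable X]setTI.
  exact: (@measurable_cons_pair _ _ n measurableT _ (@measurable_small_det R _ delta)).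
have := measurable_fun_xsection (gauss_mx R n n.+1) mB.
congr (measurable_fun _ _); apply/funext => r /=; congr (gauss_mx _ _ _ _).
by apply/seteqP; split=> X; rewrite /xsection/= inE.
Qed.

Lemma small_det_probS n delta : small_det_prob n.+1 delta =
  (\int[gauss_row R n.+1]_r gauss_mx R n n.+1 [set X : n.-tuple (n.+1.-tuple K) |
      small_det delta [tuple of r :: X]])%E.
Proof. exact: tprodS. Qed.

(** Given the row, the threshold becomes [delta / sqnorm r]; as the bound is a pure power, the row
    contributes a separate factor. *)
Lemma small_det_prob_rec a n (M : R) : 0 <= M ->
  (forall delta, 0 < delta -> (small_det_prob n delta <= (M * delta `^ a)%:E)%E) ->
  forall delta, 0 < delta ->
  (small_det_prob n.+1 delta <= (M * delta `^ a)%:E * neg_moment a n.+1)%E.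
Proof.
move=> M0 pM delta d0; rewrite small_det_probS.
pose Z : set (n.+1.-tuple K) := [set r | sqnorm r = 0].
have mZ : measurable Z.
  rewrite (_ : Z = @sqnorm R n.+1 @^-1` [set 0])//.
  rewrite -[X in measurable X]setTI; exact: measurable_sqnorm.
have mneg := @measurable_neg_weight R a n.+1.
have Md0 : 0 <= M * delta `^ a by rewrite mulr_ge0// powR_ge0.
have mMneg : measurable_fun setT (fun r : n.+1.-tuple K =>
    ((M * delta `^ a)%:E * (neg_weight a r)%:E)%E) by exact: emeasurable_funM.
have mI : measurable_fun setT (fun r : n.+1.-tuple K => (\1_Z r)%:E : \bar R).
  by apply/measurable_EFinP; exact: measurable_indic.
have Mneg0 (r : n.+1.-tuple K) : (0 <= (M * delta `^ a)%:E * (neg_weight a r)%:E)%E.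
  by rewrite mule_ge0// lee_fin// neg_weight_ge0.
(* At r = 0 the conditional probability is only known to be at most 1; the indicator of this null
   event absorbs it. *)
apply: (@le_trans _ _ (\int[gauss_row R n.+1]_r
   ((\1_Z r)%:E + (M * delta `^ a)%:E * (neg_weight a r)%:E))%E); last first.
  rewrite ge0_integralD//.
  rewrite integral_indic// setIT [X in (X + _)%E]gauss_row_sqnorm_eq0 add0e.
  by rewrite ge0_integralZl// => r _; rewrite lee_fin neg_weight_ge0.
apply: ge0_le_integral.
- by [].
- by move=> r _; exact: measure_ge0.
- exact: measurable_small_det_section.
- exact: emeasurable_funD.
move=> r _; rewrite indicE.
have [S0|S0] := eqVneq (sqnorm r) 0.
  rewrite mem_set//=; apply: (le_trans (probability_le1 _ _)).
    have := @measurable_cons _ _ _ _ (fun=> r) n id (@measurable_cst _ _ _ _ _ _)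
      (@measurable_id _ _ _) measurableT _ (@measurable_small_det R n.+1 delta).
    by rewrite setTI.
  by rewrite leeDl.
rewrite memNset/=; last exact/eqP.
rewrite add0e small_det_section//.
have Sp : 0 < sqnorm r by rewrite lt_neqAle eq_sym S0 sqnorm_ge0.
apply: (le_trans (pM _ _)); first by rewrite divr_gt0.
rewrite -EFinM lee_fin /neg_weight S0 mul1r powRM ?invr_ge0 ?sqnorm_ge0 ?(ltW d0)//.
by rewrite mulrA.
Qed.

(* Chernoff bound with parameter [delta^-1]. *)
Lemma small_det_prob1_le a delta : 0 <= a -> a <= 1 -> 0 < delta ->
  (small_det_prob 1 delta <= (expR 1 * delta `^ a)%:E)%E.
Proof.
move=> a0 a1 d0; rewrite small_det_probS.
have di0 : 0 <= delta^-1 by rewrite invr_ge0 ltW.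
have ml := @measurable_laplace R 1 delta^-1.
have mel : measurable_fun setT (fun r : 1.-tuple K => (expR (- (delta^-1 * sqnorm r)))%:E).
  by apply/measurable_EFinP; exact: ml.
apply: (@le_trans _ _ (\int[gauss_row R 1]_r
   ((expR 1)%:E * (expR (- (delta^-1 * sqnorm r)))%:E))%E).
  apply: ge0_le_integral.
  - by [].
  - by move=> r _; exact: measure_ge0.
  - exact: measurable_small_det_section.
  - exact: emeasurable_funM.
  move=> r _; rewrite -EFinM -expRD.
  have mr : measurable [set X : 0.-tuple (1.-tuple K) | small_det delta [tuple of r :: X]].
    have := @measurable_cons _ _ _ _ (fun=> r) 0 id (@measurable_cst _ _ _ _ _ _)
      (@measurable_id _ _ _) measurableT _ (@measurable_small_det R 1 delta).
    by rewrite setTI.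
  have [Sd|Sd] := leP (sqnorm r) delta.
    apply: (le_trans (probability_le1 _ mr)); rewrite lee_fin -[leLHS]expR0 ler_expR.
    by rewrite subr_ge0 mulrC ler_pdivrMr// mul1r.
  have S0 : sqnorm r != 0 by rewrite gt_eqF// (lt_trans d0).
  (* The remaining matrix is empty, with determinant 1, so the event is impossible once the entry
     exceeds the threshold. *)
  rewrite small_det_section// (_ : small_det _ = set0) ?measure0 ?lee_fin ?expR_ge0//.
  apply/seteqP; split=> // X; rewrite /small_det/= det_mx00.
  rewrite /normc2/= expr1n expr0n addr0 ltr_pdivlMr ?(lt_trans d0)// mul1r.
  by move=> /(lt_trans Sd); rewrite ltxx.
rewrite ge0_integralZl//.
rewrite laplace_sqnorm// expr1 -EFinM lee_fin ler_wpM2l ?expR_ge0//.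
(* delta / (1 + delta) is at most min(1, delta), hence at most delta^a for 0 <= a <= 1. *)
have [d1|d1] := leP delta 1.
  apply: (@le_trans _ _ delta); last by apply: ger1_powR => //; rewrite d0.
  have -> : (1 + delta^-1)^-1 = delta / (1 + delta).
    by field; rewrite !gt_eqF//; lra.
  by rewrite ler_pdivrMr; nra.
apply: (@le_trans _ _ 1).
  by rewrite invf_le1; lra.
by rewrite -[leLHS](powRr0 delta) ler_powR// ltW.
Qed.

Lemma powR_inv (x a : R) : 0 <= x -> x^-1 `^ a = (x `^ a)^-1.
Proof. by move=> x0; rewrite -powR_inv1// -powRrM mulN1r powRN. Qed.

(** Each factor is put in the form of a quotient of consecutive terms of a sequence, so that the
    product over sizes telescopes exactly. *)
Lemma neg_moment_factor (a : R) m : 0 <= a -> a <= 1 ->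
  (neg_moment a m.+4 <= (((m.+4%:R : R) `^ a)^-1 *
    expR (m.+1%:R^-1 - m.+2%:R^-1 : R) *
    (m.+2%:R / m.+1%:R : R) `^ (a * (a + 1) / 2))%:E)%E.
Proof.
move=> a0 a1; apply: (le_trans (neg_moment_le a0 a1 (erefl _))); rewrite lee_fin.
set N : R := m.+3%:R.
have N3 : 3 <= N by rewrite ler_nat.
have N1 : m.+2%:R = N - 1 by rewrite /N -(addn1 m.+2) natrD addrK.
have N2 : m.+1%:R = N - 2 by rewrite /N -(addn2 m.+1) natrD addrK.
have N4 : m.+4%:R = N + 1 by rewrite /N -(addn1 m.+3) natrD.
rewrite N1 N2 N4; set g := a * (a + 1) / 2.
pose B := a * (1 - a) / 2; pose C := a * (1 - a) * (2 - a) / 6.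
have B0 : 0 <= B by rewrite /B !mulr_ge0//; lra.
(* Lets the cubic term be bounded by 1 / ((N-1)(N-2)), a difference of consecutive inverses. *)
have C1 : C * 4 <= 1 by rewrite /C; nra.
have g0 : 0 <= g by rewrite /g !mulr_ge0//; lra.
rewrite -/B -/C.
have -> : N^-1 `^ a = ((N + 1) `^ a)^-1 * (1 + N^-1) `^ a.
  rewrite -powR_inv; last lra.
  rewrite -powRM ?invr_ge0; try lra.
    by congr (_ `^ _); field; rewrite !gt_eqF//; lra.
  by rewrite addr_ge0// invr_ge0; lra.
have e1 : (1 + N^-1) `^ a <= expR (a / (N - 1)).
  apply: (@le_trans _ _ (expR N^-1 `^ a)).
    by apply: ge0_ler_powR => //; rewrite ?nnegrE ?expR_ge0// ?expR_ge1Dx// addr_ge0// invr_ge0; lra.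
  rewrite -expRM ler_expR mulrC ler_wpM2l// lef_pV2 ?posrE; lra.
set Q := 1 - _ + _.
have e2 : Q <= expR (- (B / (N - 1)) + ((N - 2)^-1 - (N - 1)^-1)).
  apply: (le_trans _ (expR_ge1Dx _)); rewrite /Q -addrA lerD2l lerD2l.
  have -> : (N - 2)^-1 - (N - 1)^-1 = 1 / ((N - 1) * (N - 2)).
    by field; rewrite !gt_eqF//; lra.
  by rewrite ler_wpM2r// invr_ge0 mulr_ge0; lra.
(* After inversion this is exp(-1/(N-1)) >= 1 - 1/(N-1) = (N-2)/(N-1), raised to the power g. *)
have e3 : expR (g / (N - 1)) <= ((N - 1) / (N - 2)) `^ g.
  rewrite mulrC expRM; apply: ge0_ler_powR => //; rewrite ?nnegrE ?expR_ge0//.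
    by rewrite divr_ge0; lra.
  rewrite -[leLHS]invrK -expRN -[leRHS]invrK lef_pV2 ?posrE ?expR_gt0//; last first.
    by rewrite invr_gt0 divr_gt0; lra.
  apply: (le_trans _ (expR_ge1Dx _)); rewrite le_eqVlt; apply/orP; left; apply/eqP.
  by field; rewrite !gt_eqF//; lra.
rewrite -!mulrA ler_wpM2l ?invr_ge0 ?powR_ge0//.
have p0 : 0 <= (1 + N^-1) `^ a by exact: powR_ge0.
apply: (@le_trans _ _ (expR (a / (N - 1)) *
    expR (- (B / (N - 1)) + ((N - 2)^-1 - (N - 1)^-1)))).
  apply: (@le_trans _ _ ((1 + N^-1) `^ a *
      expR (- (B / (N - 1)) + ((N - 2)^-1 - (N - 1)^-1)))).
    exact: ler_wpM2l.
  by rewrite ler_wpM2r// expR_ge0.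
apply: (@le_trans _ _ (expR ((N - 2)^-1 - (N - 1)^-1) * expR (g / (N - 1)))).
  rewrite -!expRD ler_expR le_eqVlt; apply/orP; left; apply/eqP.
  (* The exponents agree because a - B = g. *)
  by rewrite /g /B; field; rewrite !gt_eqF//; lra.
by rewrite ler_wpM2l// expR_ge0.
Qed.

(* [6 = 3`!], and [expR 1 ^+ 2] absorbs the base case [expR 1] of
   [small_det_prob_le] together with its factor [expR (- 1)]. *)
Definition small_ball_const (a : R) : R := expR 1 ^+ 2 * 6 `^ a.

(** Starts at size 3 because [neg_moment_factor] bounds the passage to size [m.+4]. The exponential
    and the power of [m.+1] are the telescoped products of its factors. *)
Lemma small_det_prob_le (a : R) m delta : 0 <= a -> a <= 1 -> 0 < delta ->
  (small_det_prob m.+3 delta <= (small_ball_const a / ((m.+3`!)%:R : R) `^ a *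
     expR (- m.+1%:R^-1 : R) * (m.+1%:R : R) `^ (a * (a + 1) / 2) * delta `^ a)%:E)%E.
Proof.
move=> a0 a1; have E0 : 0 <= small_ball_const a.
  by rewrite mulr_ge0 ?exprn_ge0 ?expR_ge0 ?powR_ge0.
elim: m delta => [|m IHm] delta d0.
  have step n (pn : forall t, 0 < t -> (small_det_prob n.+1 t <= (expR 1 * t `^ a)%:E)%E) t :
      0 < t -> (small_det_prob n.+2 t <= (expR 1 * t `^ a)%:E)%E.
    move=> t0; apply: (le_trans (small_det_prob_rec (expR_ge0 1) pn t0)).
    rewrite -[leRHS]mule1 lee_wpmul2l//; last exact: neg_moment_le1.
    by rewrite lee_fin mulr_ge0 ?expR_ge0 ?powR_ge0.
  (* Passing from size 1 to 3 keeps the constant [expR 1], both negative moments being at most 1. *)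
  apply: (le_trans (step 1 (step 0 (fun t => @small_det_prob1_le a t a0 a1)) delta d0)).
  rewrite lee_fin ler_wpM2r ?powR_ge0//.
  rewrite /small_ball_const (_ : 3`! = 6)%N// powR1 mulr1 invr1.
  have p6 : 0 < (6 : R) `^ a by rewrite powR_gt0.
  by rewrite expRN mulfK ?gt_eqF// expr2 mulfK// gt_eqF// expR_gt0.
set Mm : R := small_ball_const a / ((m.+3`!)%:R : R) `^ a *
     expR (- m.+1%:R^-1 : R) * (m.+1%:R : R) `^ (a * (a + 1) / 2).
have M0 : 0 <= Mm by rewrite !mulr_ge0 ?invr_ge0 ?powR_ge0 ?expR_ge0.
apply: (le_trans (small_det_prob_rec M0 IHm d0)).
have Md0 : (0 <= (Mm * delta `^ a)%:E)%E by rewrite lee_fin mulr_ge0// powR_ge0.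
apply: (le_trans (lee_wpmul2l Md0 (neg_moment_factor m a0 a1))).
rewrite -EFinM lee_fin le_eqVlt; apply/orP; left; apply/eqP.
have E1 : ((m.+4`!)%:R : R) `^ a = (m.+4%:R : R) `^ a * ((m.+3`!)%:R : R) `^ a.
  by rewrite factS natrM powRM.
have E2 : (m.+2%:R / m.+1%:R : R) `^ (a * (a + 1) / 2) =
    (m.+2%:R : R) `^ (a * (a + 1) / 2) / (m.+1%:R : R) `^ (a * (a + 1) / 2).
  by rewrite powRM ?invr_ge0// powR_inv.
rewrite /Mm E1 E2 expRD expRN.
have x1 : (m.+1%:R : R) `^ (a * (a + 1) / 2) != 0 by rewrite gt_eqF// powR_gt0.
have x2 : expR (m.+1%:R^-1 : R) != 0 by rewrite gt_eqF// expR_gt0.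
have x3 : (m.+4%:R : R) `^ a != 0 by rewrite gt_eqF// powR_gt0.
have x4 : ((m.+3`!)%:R : R) `^ a != 0 by rewrite gt_eqF// powR_gt0// ltr0n fact_gt0.
move: x1 x2 x3 x4.
move: ((m.+1%:R : R) `^ (a * (a + 1) / 2)) (expR (m.+1%:R^-1 : R)) ((m.+4%:R : R) `^ a)
  (((m.+3`!)%:R : R) `^ a) ((m.+2%:R : R) `^ (a * (a + 1) / 2)) (expR (- (m.+2%:R^-1 : R))) => v1 v2 v3 v4 v5 v6.
by move=> x1 x2 x3 x4; field; rewrite ?x1 ?x2 ?x3 ?x4.
Qed.

(** With delta = eps^2 n! the factor n!^a of delta^a cancels the denominator in [small_det_prob_le].
    Sizes 1 and 2 fit the same constant because n! <= 6. *)
Lemma small_det_prob_fact_le (a : R) n (eps : R) : 0 <= a -> a <= 1 -> 0 < eps ->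
  (small_det_prob n.+1 (eps ^+ 2 * (n.+1`!)%:R) <=
    (small_ball_const a * (n.+1%:R : R) `^ (a * (a + 1) / 2) * eps `^ (2 * a))%:E)%E.
Proof.
move=> a0 a1 e0; have g0 : 0 <= a * (a + 1) / 2 by rewrite !mulr_ge0//; lra.
have d0 k : 0 < eps ^+ 2 * (k.+1`!)%:R by rewrite mulr_gt0 ?exprn_gt0// ltr0n fact_gt0.
have dE k : (eps ^+ 2 * (k.+1`!)%:R) `^ a = eps `^ (2 * a) * (k.+1`!)%:R `^ a.
  by rewrite powRM ?exprn_ge0 ?ltW// powRrM powR_mulrn// ltW.
have p0 := powR_ge0 eps (2 * a).
have small k : (k < 2)%N -> (small_det_prob k.+1 (eps ^+ 2 * (k.+1`!)%:R) <=
    (expR 1 * (eps ^+ 2 * (k.+1`!)%:R) `^ a)%:E)%E ->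
  (small_det_prob k.+1 (eps ^+ 2 * (k.+1`!)%:R) <=
    (small_ball_const a * (k.+1%:R : R) `^ (a * (a + 1) / 2) * eps `^ (2 * a))%:E)%E.
  move=> k2 /le_trans; apply; rewrite lee_fin dE mulrCA mulrC ler_wpM2r//.
  have n1 : 1 <= (k.+1%:R : R) `^ (a * (a + 1) / 2).
    by rewrite -[leLHS](powRr0 (k.+1%:R : R)) ler_powR// ler1n.
  apply: (@le_trans _ _ (small_ball_const a)); last by rewrite ler_peMr// mulr_ge0 ?exprn_ge0 ?expR_ge0 ?powR_ge0.
  apply: ler_pM; rewrite ?expR_ge0 ?powR_ge0//.
    by rewrite expr2 ler_peMr ?expR_ge0// -[leLHS]expR0 ler_expR.
  apply: ge0_ler_powR; rewrite ?nnegrE//.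
  by rewrite ler_nat; case: k k2 {n1} => [|[]].
have p1 t : 0 < t -> (small_det_prob 1 t <= (expR 1 * t `^ a)%:E)%E by exact: small_det_prob1_le.
case: n => [|[|n]].
- by apply: small => //; exact: p1.
- apply: small => //; apply: (le_trans (small_det_prob_rec (expR_ge0 1) p1 (d0 1))).
  rewrite -[leRHS]mule1 lee_wpmul2l//; last exact: neg_moment_le1.
  by rewrite lee_fin mulr_ge0 ?expR_ge0 ?powR_ge0.
apply: (le_trans (small_det_prob_le n a0 a1 (d0 _))); rewrite lee_fin dE.
have f0 : ((n.+3`!)%:R : R) `^ a != 0 by rewrite gt_eqF// powR_gt0// ltr0n fact_gt0.
rewrite [leLHS](_ : _ = small_ball_const a *
  (expR (- n.+1%:R^-1 : R) * (n.+1%:R : R) `^ (a * (a + 1) / 2)) * eps `^ (2 * a)); last first.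
  by field.
rewrite ler_wpM2r//.
rewrite ler_wpM2l//; first by rewrite mulr_ge0 ?exprn_ge0 ?expR_ge0 ?powR_ge0.
apply: (@le_trans _ _ (1 * (n.+1%:R : R) `^ (a * (a + 1) / 2))).
  by rewrite ler_wpM2r ?powR_ge0// -expR0 ler_expR oppr_le0 invr_ge0.
by rewrite mul1r; apply: ge0_ler_powR; rewrite ?nnegrE// ler_nat -addn2 leq_addr.
Qed.

Lemma ltc_norm_sqrt (z : R[i]) n (eps : R) : 0 < eps ->
  (`|z| < (eps * Num.sqrt (n`!)%:R)%:C%C) = (normc2 z < eps ^+ 2 * (n`!)%:R).
Proof.
move=> e0; rewrite normc_def ltcR.
rewrite -{1}(ger0_norm (ltW e0)) -sqrtr_sqr -sqrtrM ?sqr_ge0// ltr_sqrt//.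
by rewrite mulr_gt0 ?exprn_gt0// ltr0n fact_gt0.
Qed.

End small_ball.

Theorem theorem50 (R : realType) (beta : R) (hbeta0 : 0 <= beta)
    (hbeta2 : beta < 2) :
  exists C : R,
  forall (n : nat) (eps : R), (0 < n)%N -> 0 < eps ->
  forall (d : measure_display) (T : measurableType d) (P : probability T R)
         (X : T -> 'M[R[i]]_n),
    gaussian_matrix P X ->
    (P [set t | (`|\det (X t)| < (eps * Num.sqrt (n`!)%:R)%:C%C)%R] <
     (C * n%:R `^ (beta * (beta + 2) / 8) * eps `^ beta)%:E)%E.
Proof.
pose a := beta / 2.
(* The added 1 turns the weak bound into a strict one, the other two factors being positive. *)
exists (small_ball_const a + 1) => -[//|n] eps _ e0 d T P X gX.
have a0 : 0 <= a by rewrite divr_ge0.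
have a1 : a <= 1 by rewrite /a; lra.
have -> : beta * (beta + 2) / 8 = a * (a + 1) / 2 by rewrite /a; field.
have -> : [set t | (`|\det (X t)| < (eps * Num.sqrt (n.+1`!)%:R)%:C%C)%R] =
    [set t | small_det (eps ^+ 2 * (n.+1`!)%:R) (tuple_of_mx (X t))].
  by apply/funext => t; rewrite /small_det/= tuple_of_mxK ltc_norm_sqrt.
rewrite (gaussian_matrix_law gX); last exact: measurable_small_det.
apply: (le_lt_trans (small_det_prob_fact_le n a0 a1 e0)).
rewrite lte_fin (_ : 2 * a = beta); last by rewrite /a; field.
by rewrite !ltr_pM2r ?powR_gt0// ltrDl.
Qed.
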